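(* Any cleft quantum principal $H_4$-bundle over a commutative $k$-algebra $C$ in which $2$ is invertible is homotopically trivial.
   Context: Fix a field $k$. All algebras are associative unital $k$-algebras, algebra morphisms preserve units, and $\otimes$ without subscript means $\otimes_k$. For a Hopf algebra $H$ write $\Delta(h)=\sum_{(h)}h_{(1)}\otimes h_{(2)}$ for its coproduct and $\varepsilon$ for its counit. Sweedler's Hopf algebra $H_4$ is the four-dimensional $k$-algebra generated by $X,Y$ with relations $X^2=1$, $Y^2=0$, $XY+YX=0$, with $\Delta(X)=X\otimes X$, $\Delta(Y)=1\otimes Y+Y\otimes X$, $\varepsilon(X)=1$, $\varepsilon(Y)=0$, and antipode $S(X)=X$, $S(Y)=XY$. An $H$-comodule algebra is an algebra $A$ with a right $H$-comodule structure whose coaction $\Delta_A: A\to A\otimes H$ is a morphism of algebras. Its base is the subalgebra of coinvariants $A^{\mathrm{co}\,H}=\{a\in A : \Delta_A(a)=a\otimes 1_H\}$; if $C=A^{\mathrm{co}\,H}$ one says that $C\subset A$ is an $H$-extension. It is Galois if the map $A\otimes_C A\to A\otimes H$, $a\otimes b\mapsto (a\otimes 1_H)\Delta_A(b)$, is bijective. For a commutative algebra $C$, a quantum principal $H$-bundle over (with base) $C$ is a Galois $H$-extension $C\subset A$ such that $C$ is central in $A$ and $A$ is faithfully flat as a $C$-module. Two such bundles are isomorphic ($\cong$) if there is an isomorphism of $H$-comodule algebras between them. For a morphism $f:C\to C'$ of commutative algebras, the push-forward of a quantum principal $H$-bundle $A$ over $C$ is $f_*A=C'\otimes_C A$ with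 multiplication $(c_1'\otimes a_1)(c_2'\otimes a_2)=c_1'c_2'\otimes a_1a_2$ and coaction $\mathrm{id}_{C'}\otimes_C\Delta_A$; it is a quantum principal $H$-bundle over $C'$. For a commutative algebra $K$, let $[0],[1]:K[t]\to K$ be the $K$-algebra morphisms sending $t$ to $0$ and $1$ respectively. Let $\mathcal{C}_{\text{ét}}$ be the class of finite étale morphisms of commutative algebras. For two quantum principal $H$-bundles $A,A'$ over $C$, write $A\sim A'$ if there exist a morphism $i:C\to\bar C$ in $\mathcal{C}_{\text{ét}}$ and a quantum principal $H$-bundle $B$ with base $\bar C[t]$ such that $[0]_*B\cong i_*A$ and $[1]_*B\cong i_*A'$. Homotopy equivalence of quantum principal $H$-bundles over $C$ is the equivalence relation generated by $\sim$. A quantum principal $H$-bundle over $C$ is trivial if it is isomorphic to the $H$-comodule algebra $C\otimes H$ with coaction $\mathrm{id}_C\otimes\Delta$; it is homotopically trivial if it is homotopy equivalent to a trivial quantum principal $H$-bundle over $C$. An $H$-extension $C\subset A$ is cleft if there exists a morphism $\gamma:H\to A$ of right $H$-comodules that is convolution invertible, i.e. there is a linear map $\gamma':H\to A$ with $\sum_{(h)}\gamma(h_{(1)})\gamma'(h_{(2)})=\sum_{(h)}\gamma'(h_{(1)})\gamma(h_{(2)})=\varepsilon(h)1_A$ for all $h\in H$. *)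

(* Defs.v *)
From HB Require Import structures.
From mathcomp Require Import all_boot all_algebra.
From mathcomp Require Import boolp.
From mathcomp Require Import mpoly.
From mathcomp Require Import ring.

Set Implicit Arguments.
Unset Strict Implicit.
Unset Printing Implicit Defensive.

Import GRing.Theory.
Local Open Scope ring_scope.
Local Open Scope quotient_scope.

Section Tens.
Variables (R : Type) (M N : zmodType) (ra : M -> R -> M) (la : R -> N -> N).

(* M ⊗_R N, for a right action ra of R on M and a left action la of R on N:   *)
(* formal sums of pairs modulo the congruence generated by biadditivity and   *)
(* balancing.  As the sums form a monoid and not a group, (0, n) ~ 0 has to   *)
(* be imposed; it makes (- m, n) the opposite of (m, n).                      *)
Inductive tens_eqv : seq (M * N) -> seq (M * N) -> Prop :=
| TensRefl s : tens_eqv s s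
| TensSym s t : tens_eqv s t -> tens_eqv t s
| TensTrans s t u : tens_eqv s t -> tens_eqv t u -> tens_eqv s u
| TensCat s s' t t' : tens_eqv s s' -> tens_eqv t t' ->
    tens_eqv (s ++ t) (s' ++ t')
| TensC s t : tens_eqv (s ++ t) (t ++ s)
| TensDl m m' n : tens_eqv [:: (m + m', n)] [:: (m, n); (m', n)]
| TensDr m n n' : tens_eqv [:: (m, n + n')] [:: (m, n); (m, n')]
| Tens0l n : tens_eqv [:: (0, n)] [::]
| TensBal m r n : tens_eqv [:: (ra m r, n)] [:: (m, la r n)].

Definition tens_rel : rel (seq (M * N)) := fun s t => `[< tens_eqv s t >].

Lemma tens_rel_refl : reflexive tens_rel.
Proof. by move=> s; apply/asboolP; apply: TensRefl. Qed.
Lemma tens_rel_sym : ssrbool.symmetric tens_rel.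
Proof. by move=> s t; apply/asboolP/asboolP; apply: TensSym. Qed.
Lemma tens_rel_trans : transitive tens_rel.
Proof.
by move=> t s u /asboolP st /asboolP tu; apply/asboolP; apply: TensTrans st tu.
Qed.

Canonical tens_equiv := EquivRel tens_rel tens_rel_refl tens_rel_sym tens_rel_trans.

Definition tens := {eq_quot tens_equiv}.
HB.instance Definition _ := Choice.on tens.
HB.instance Definition _ := EqQuotient.on tens.

Definition tsum (s : seq (M * N)) : tens := \pi_tens s.
Definition tpure (m : M) (n : N) : tens := tsum [:: (m, n)].

Lemma tsumP s t : tens_eqv s t <-> tsum s = tsum t.
Proof.
split=> [st|/eqmodP/asboolP//].
by apply/eqmodP/asboolP.
Qed.

Definition tadd (x y : tens) : tens := tsum (repr x ++ repr y).
Definition topp (x : tens) : tens := tsum [seq (- p.1, p.2) | p <- repr x].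

Lemma repr_tsum s : tens_eqv (repr (tsum s)) s.
Proof. by apply/tsumP; rewrite /tsum reprK. Qed.

Lemma tsum_cat s t : tsum (s ++ t) = tadd (tsum s) (tsum t).
Proof. by apply/tsumP/TensCat; apply/TensSym/repr_tsum. Qed.

Lemma taddA : associative tadd.
Proof.
move=> x y z; rewrite -[x]reprK -[y]reprK -[z]reprK -!/(tsum _).
by rewrite -!tsum_cat catA.
Qed.
Lemma taddC : commutative tadd.
Proof. by move=> x y; apply/tsumP/TensC. Qed.
Lemma tadd0 : left_id (tsum [::]) tadd.
Proof. by move=> x; rewrite -[x]reprK -!/(tsum _) -tsum_cat. Qed.

Lemma tens_oppP s : tens_eqv ([seq (- p.1, p.2) | p <- s] ++ s) [::].
Proof.
elim: s => [|[m n] s IHs] /=; first exact: TensRefl.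
apply: (@TensTrans _ ([:: (-m, n); (m,n)] ++ ([seq (- p.1, p.2) | p <- s] ++ s))).
  rewrite -cat1s -[(m, n) :: s]cat1s -[X in tens_eqv _ X]/([:: (-m,n)] ++ ([:: (m, n)] ++ _)).
  by apply: TensCat; [exact: TensRefl|rewrite !catA; apply: TensCat; [exact: TensC|exact: TensRefl]].
rewrite -[X in tens_eqv _ X]cat0s; apply: TensCat => //.
apply: TensTrans (TensSym (TensDl _ _ _)) _; rewrite addNr; exact: Tens0l.
Qed.

Lemma taddN : left_inverse (tsum [::]) topp tadd.
Proof.
move=> x; rewrite -[X in tadd _ X]reprK -/(tsum _) /topp -tsum_cat.
by apply/tsumP/tens_oppP.
Qed.

HB.instance Definition _ :=
  GRing.isZmodule.Build tens taddA taddC tadd0 taddN.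

Lemma tsumD s t : tsum (s ++ t) = tsum s + tsum t.
Proof. exact: tsum_cat. Qed.

Lemma tpureDl m m' n : tpure (m + m') n = tpure m n + tpure m' n.
Proof.
by rewrite /tpure -tsumD; apply/tsumP/TensDl.
Qed.
Lemma tpureDr m n n' : tpure m (n + n') = tpure m n + tpure m n'.
Proof.
by rewrite /tpure -tsumD; apply/tsumP/TensDr.
Qed.
Lemma tpure_bal m r n : tpure (ra m r) n = tpure m (la r n).
Proof. exact/tsumP/TensBal. Qed.
Lemma tpure0l n : tpure 0 n = 0.
Proof. exact/tsumP/Tens0l. Qed.
Lemma tpure0r m : tpure m 0 = 0.
Proof. by apply: (addIr (tpure m 0)); rewrite -tpureDr !add0r. Qed.

Lemma tens_ind (P : tens -> Prop) :
  P 0 -> (forall m n, P (tpure m n)) ->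
  (forall x y, P x -> P y -> P (x + y)) -> forall x, P x.
Proof.
move=> P0 P1 PD x; rewrite -[x]reprK -/(tsum _); elim: (repr x) => [|[m n] s IHs]; first exact: P0.
by rewrite -cat1s tsumD; apply: PD => //; apply: P1.
Qed.

Section Lift.
Variables (V : zmodType) (b : M -> N -> V).

Definition balanced : Prop :=
  [/\ forall m m' n, b (m + m') n = b m n + b m' n,
      forall m n n', b m (n + n') = b m n + b m n'
    & forall m r n, b (ra m r) n = b m (la r n)].

(* Only meaningful when b is balanced; see tliftE and tliftD. *)
Definition tlift (x : tens) : V := \sum_(p <- repr x) b p.1 p.2.

Hypothesis bP : balanced.

Lemma bal0l n : b 0 n = 0.
Proof. by case: bP => bD _ _; apply: (addIr (b 0 n)); rewrite -bD !add0r. Qed.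

Lemma tens_eqv_lift s t : tens_eqv s t ->
  \sum_(p <- s) b p.1 p.2 = \sum_(p <- t) b p.1 p.2.
Proof.
case: (bP) => bDl bDr bB.
elim=> {s t} //= [s t u _ -> _ -> //|s s' t t' _ IHs _ IHt|s t|m m' n|m n n'|n|m r n].
- by rewrite !big_cat /= IHs IHt.
- by rewrite !big_cat /= addrC.
- by rewrite !big_cons !big_nil /= !addr0.
- by rewrite !big_cons !big_nil /= !addr0.
- by rewrite big_cons !big_nil addr0 bal0l.
- by rewrite !big_cons !big_nil /= !addr0.
Qed.

Lemma tlift_tsum s : tlift (tsum s) = \sum_(p <- s) b p.1 p.2.
Proof. exact/tens_eqv_lift/repr_tsum. Qed.

Lemma tliftE m n : tlift (tpure m n) = b m n.
Proof. by rewrite tlift_tsum big_cons big_nil addr0. Qed.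

Lemma tliftD x y : tlift (x + y) = tlift x + tlift y.
Proof.
by rewrite -[x]reprK -[y]reprK -!/(tsum _) -tsumD !tlift_tsum big_cat.
Qed.

Lemma tlift0 : tlift 0 = 0.
Proof. by rewrite [0](_ : _ = tsum [::]) // tlift_tsum big_nil. Qed.
End Lift.
End Tens.

Arguments tpure {R M N ra la} m n.
Arguments tlift {R M N ra la V} b x.
Arguments tens_ind [R M N ra la] P.

Section MorphExt.
Variables (V W : zmodType) (f : V -> W).
Hypothesis fD : {morph f : x y / x + y}.
Lemma morphD0 : f 0 = 0.
Proof. by apply: (addIr (f 0)); rewrite -fD !add0r. Qed.
Lemma morphDN : {morph f : x / - x}.
Proof. by move=> x; apply: (addIr (f x)); rewrite -fD !addNr morphD0. Qed.
End MorphExt.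

Section TensExt.
Variables (R : Type) (M N V : zmodType) (ra : M -> R -> M) (la : R -> N -> N).
Implicit Types f g : tens ra la -> V.

Lemma tens_ext f g :
  {morph f : x y / x + y} -> {morph g : x y / x + y} ->
  (forall m n, f (tpure m n) = g (tpure m n)) -> f =1 g.
Proof.
move=> fD gD fg; elim/tens_ind => [|m n|x y fx fy]; rewrite ?morphD0 ?fg //.
by rewrite fD gD fx fy.
Qed.

Lemma eq_tlift (b b' : M -> N -> V) : b =2 b' ->
  @tlift R M N ra la V b =1 tlift b'.
Proof. by move=> bb' x; apply: eq_bigr => p _; apply: bb'. Qed.
End TensExt.

Section TensMap.
Variables (R : Type) (M N : zmodType) (ra : M -> R -> M) (la : R -> N -> N).
Variables (R' : Type) (M' N' : zmodType).
Variables (ra' : M' -> R' -> M') (la' : R' -> N' -> N').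

Definition tmap (f : M -> M') (g : N -> N') : tens ra la -> tens ra' la' :=
  tlift (fun m n => tpure (f m) (g n)).

Variables (f : M -> M') (g : N -> N').
Hypothesis (fD : {morph f : x y / x + y}) (gD : {morph g : x y / x + y}).
Hypothesis (fgB : forall m r n,
  tpure (f (ra m r)) (g n) = tpure (f m) (g (la r n)) :> tens ra' la').

Lemma tmap_balanced :
  balanced ra la (fun m n => tpure (f m) (g n) : tens ra' la').
Proof. by split=> * //; rewrite (fD, gD) (tpureDl, tpureDr). Qed.

Lemma tmapE m n : tmap f g (tpure m n) = tpure (f m) (g n).
Proof. by rewrite /tmap tliftE //; apply: tmap_balanced. Qed.

Lemma tmapD : {morph tmap f g : x y / x + y}.
Proof. by move=> x y; apply/tliftD/tmap_balanced. Qed.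
End TensMap.

Arguments tmap {R M N ra la R' M' N' ra' la'} f g x.

Section TensMul.
Variables (R : Type) (A B : pzRingType) (ra : A -> R -> A) (la : R -> B -> B).
Local Notation T := (tens ra la).
Hypothesis raMl : forall a a' r, ra (a * a') r = ra a r * a'.
Hypothesis raMr : forall a a' r, ra (a * a') r = a * ra a' r.
Hypothesis laMl : forall r b b', la r (b * b') = la r b * b'.
Hypothesis laMr : forall r b b', la r (b * b') = b * la r b'.

Definition tmul (x y : T) : T :=
  tlift (fun a b => tlift (fun a' b' => tpure (a * a') (b * b')) y) x.

Let bal2 a b : balanced ra la (fun a' b' => tpure (a * a') (b * b') : T).
Proof.
split=> [a1 a2 b'|a' b1 b2|a' r b']; rewrite ?mulrDr ?(tpureDl, tpureDr) //.
by rewrite -raMr -laMr tpure_bal.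
Qed.

Let bal1 (y : T) : balanced ra la
  (fun a b => tlift (fun a' b' => tpure (a * a') (b * b') : T) y).
Proof.
split=> [a1 a2 b|a b1 b2|a r b]; move: y; apply: tens_ext;
  try by [move=> x y; rewrite tliftD //; apply: bal2
         |move=> x y; rewrite !tliftD; try apply: bal2; rewrite addrACA].
- by move=> a' b'; rewrite !tliftE // mulrDl tpureDl.
- by move=> a' b'; rewrite !tliftE // mulrDl tpureDr.
- by move=> a' b'; rewrite !tliftE // -raMl -laMl tpure_bal.
Qed.

Lemma tmul_pure a b a' b' :
  tmul (tpure a b) (tpure a' b') = tpure (a * a') (b * b').
Proof. by rewrite /tmul !tliftE. Qed.

Lemma tmulDl : left_distributive tmul +%R.
Proof. by move=> x y z; rewrite /tmul tliftD. Qed.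

Lemma tmulDr : right_distributive tmul +%R.
Proof.
move=> x y z; move: x; apply: tens_ext.
- by move=> x x'; rewrite tmulDl.
- by move=> x x'; rewrite !tmulDl addrACA.
- by move=> a b; rewrite /tmul !tliftE ?tliftD.
Qed.

Lemma tmul0l y : tmul 0 y = 0.
Proof. by apply: (morphD0 (f := tmul^~ y)) => x x'; rewrite tmulDl. Qed.

Lemma tmul0r x : tmul x 0 = 0.
Proof. by apply: (morphD0 (f := tmul x)) => y y'; rewrite tmulDr. Qed.

Lemma tmulA : associative tmul.
Proof.
move=> x y z; elim/tens_ind: x => [|a b|x x' IHx IHx'].
- by rewrite !tmul0l.
- elim/tens_ind: y => [|a' b'|y y' IHy IHy'].
  + by rewrite tmul0l !tmul0r tmul0l.
  + elim/tens_ind: z => [|a2 b2|z z' IHz IHz'].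
    * by rewrite !tmul0r.
    * by rewrite !tmul_pure !mulrA.
    * by rewrite !tmulDr IHz IHz'.
  + by rewrite !(tmulDl, tmulDr) IHy IHy'.
- by rewrite !tmulDl IHx IHx'.
Qed.

Lemma tmul1l : left_id (tpure 1 1) tmul.
Proof.
apply: tens_ext => // [x y|a b]; first by rewrite tmulDr.
by rewrite tmul_pure !mul1r.
Qed.

Lemma tmul1r : right_id (tpure 1 1) tmul.
Proof.
apply: tens_ext => // [x y|a b]; first by rewrite tmulDl.
by rewrite tmul_pure !mulr1.
Qed.
End TensMul.

Section Tensor.
Variables (k : comNzRingType).

Section Mod.
Variables (M N : lmodType k).
Definition tensor : Type :=
  tens (fun (m : M) (c : k) => c *: m) (fun (c : k) (n : N) => c *: n).
HB.instance Definition _ := GRing.Zmodule.on tensor.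

Definition tpure_k (m : M) (n : N) : tensor := tpure m n.
Local Notation "m ⊗ n" := (tpure_k m n) (at level 35, no associativity).

Definition tscale (c : k) : tensor -> tensor := tmap (fun m => c *: m) id.

Let tscale_fD c : {morph (fun m : M => c *: m) : x y / x + y}.
Proof. by move=> x y; rewrite scalerDr. Qed.
Let tscale_bal c (m : M) (r : k) (n : N) :
  tpure (c *: (r *: m)) n = tpure (c *: m) (r *: n)
  :> tens (fun (m : M) (c : k) => c *: m) (fun (c : k) (n : N) => c *: n).
Proof. by rewrite -tpure_bal !scalerA mulrC. Qed.

Lemma tscale_pure c m n : tscale c (m ⊗ n) = (c *: m) ⊗ n.
Proof. by rewrite /tscale/tpure_k tmapE. Qed.
Lemma tscaleDr : right_distributive tscale +%R.
Proof. by move=> c x y; apply: tmapD. Qed.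
Lemma tscaleA a b v : tscale a (tscale b v) = tscale (a * b) v.
Proof.
move: v; apply: tens_ext => [x y|x y|m n]; rewrite ?tscaleDr //.
by rewrite -!/(_ ⊗ _) !tscale_pure scalerA.
Qed.
Lemma tscale1 : left_id 1 tscale.
Proof.
apply: tens_ext => [x y|x y|m n]; rewrite ?tscaleDr //.
by rewrite -!/(_ ⊗ _) !tscale_pure scale1r.
Qed.
Lemma tscaleDl v : {morph tscale^~ v : a b / a + b}.
Proof.
move=> a b; move: v; apply: tens_ext => [x y|x y|m n]; rewrite ?tscaleDr //.
  by rewrite addrACA.
by rewrite -!/(_ ⊗ _) !tscale_pure scalerDl /tpure_k tpureDl.
Qed.

HB.instance Definition _ :=
  GRing.Zmodule_isLmodule.Build k tensor tscaleA tscale1 tscaleDr tscaleDl.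
End Mod.

Section Alg.
Variables A B : algType k.

Let ra (a : A) (c : k) := c *: a.
Let la (c : k) (b : B) := c *: b.
Let raMl a a' r : ra (a * a') r = ra a r * a'. Proof. exact: scalerAl. Qed.
Let raMr a a' r : ra (a * a') r = a * ra a' r. Proof. exact: scalerAr. Qed.
Let laMl r b b' : la r (b * b') = la r b * b'. Proof. exact: scalerAl. Qed.
Let laMr r b b' : la r (b * b') = b * la r b'. Proof. exact: scalerAr. Qed.

HB.instance Definition _ := GRing.Zmodule_isPzRing.Build (tensor A B)
  (tmulA raMl raMr laMl laMr) (tmul1l raMl raMr laMl laMr)
  (tmul1r raMl raMr laMl laMr) (tmulDl raMl raMr laMl laMr)
  (tmulDr raMl raMr laMl laMr).
End Alg.
End Tensor.

Notation "m ⊗ n" := (tpure_k m n) (at level 35, no associativity) : ring_scope.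

Section TensorTheory.
Variable k : comNzRingType.

Section Mod.
Variables M N : lmodType k.
Implicit Types (m : M) (n : N).

Lemma tensorDl m m' n : (m + m') ⊗ n = m ⊗ n + m' ⊗ n.
Proof. exact: tpureDl. Qed.
Lemma tensorDr m n n' : m ⊗ (n + n') = m ⊗ n + m ⊗ n'.
Proof. exact: tpureDr. Qed.
Lemma tensor0l n : (0 : M) ⊗ n = 0. Proof. exact: tpure0l. Qed.
Lemma tensor0r m : m ⊗ (0 : N) = 0. Proof. exact: tpure0r. Qed.
Lemma tensorZl c m n : (c *: m) ⊗ n = c *: (m ⊗ n).
Proof. by rewrite [RHS]tscale_pure. Qed.
Lemma tensorZr c m n : m ⊗ (c *: n) = c *: (m ⊗ n).
Proof. by rewrite -tensorZl; apply/esym/tpure_bal. Qed.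
Lemma tensor_ind (P : tensor M N -> Prop) :
  P 0 -> (forall m n, P (m ⊗ n)) ->
  (forall x y, P x -> P y -> P (x + y)) -> forall x, P x.
Proof. exact: tens_ind. Qed.
Lemma tensor_ext (V : zmodType) (f g : tensor M N -> V) :
  {morph f : x y / x + y} -> {morph g : x y / x + y} ->
  (forall m n, f (m ⊗ n) = g (m ⊗ n)) -> f =1 g.
Proof. exact: tens_ext. Qed.
End Mod.

Lemma tensorM (A B : algType k) (a a' : A) (b b' : B) :
  (a ⊗ b) * (a' ⊗ b') = (a * a') ⊗ (b * b').
Proof.
by apply: tmul_pure => *; [exact: scalerAl|exact: scalerAr|exact: scalerAl|exact: scalerAr].
Qed.

Lemma tensorZAl (A B : algType k) c (x y : tensor A B) :
  c *: (x * y) = (c *: x) * y.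
Proof.
elim/tensor_ind: x => [|a b|x x' IHx IHx']; first by rewrite scaler0 !mul0r scaler0.
  elim/tensor_ind: y => [|a' b'|y y' IHy IHy']; first by rewrite !mulr0 scaler0.
    by rewrite -tensorZl !tensorM -tensorZl scalerAl.
  by rewrite !mulrDr scalerDr IHy IHy'.
by rewrite !(scalerDr, mulrDl) IHx IHx'.
Qed.

Lemma tensorZAr (A B : algType k) c (x y : tensor A B) :
  c *: (x * y) = x * (c *: y).
Proof.
elim/tensor_ind: x => [|a b|x x' IHx IHx']; first by rewrite !mul0r scaler0.
  elim/tensor_ind: y => [|a' b'|y y' IHy IHy'];
    first by rewrite scaler0 !mulr0 scaler0.
    by rewrite -tensorZl !tensorM -tensorZl scalerAr.
  by rewrite !(mulrDr, scalerDr) IHy IHy'.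
by rewrite !(scalerDr, mulrDl) IHx IHx'.
Qed.

End TensorTheory.

Section LinearPred.
Variables (k : pzRingType) (U V : lmodType k) (f : U -> V).
Hypothesis fL : linear f.
Lemma linD : {morph f : x y / x + y}.
Proof. by move=> x y; rewrite -[x in LHS]scale1r fL scale1r. Qed.
Lemma linZ c x : f (c *: x) = c *: f x.
Proof. by rewrite -[c *: x in LHS]addr0 fL (morphD0 linD) addr0. Qed.
End LinearPred.

Lemma linearP_pred (k : pzRingType) (U V : lmodType k) (f : U -> V) :
  {morph f : x y / x + y} -> (forall c x, f (c *: x) = c *: f x) -> linear f.
Proof. by move=> fD fZ c x y; rewrite fD fZ. Qed.

Section TensorOps.
Variable k : comNzRingType.

Definition tensor_lift (M N : lmodType k) (V : zmodType) (b : M -> N -> V) :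
  tensor M N -> V := tlift b.

Definition tensor_map (M N M' N' : lmodType k) (f : M -> M') (g : N -> N') :
  tensor M N -> tensor M' N' := tensor_lift (fun m n => f m ⊗ g n).

Definition tensor_assoc (M N P : lmodType k) :
  tensor M (tensor N P) -> tensor (tensor M N) P :=
  tensor_lift (fun m => tensor_lift (fun n p => (m ⊗ n) ⊗ p)).

Section Lift.
Variables (M N : lmodType k) (V : zmodType) (b : M -> N -> V).
Hypothesis bDl : forall m m' n, b (m + m') n = b m n + b m' n.
Hypothesis bDr : forall m n n', b m (n + n') = b m n + b m n'.
Hypothesis bB : forall c m n, b (c *: m) n = b m (c *: n).

Let bbal : balanced (fun (m : M) (c : k) => c *: m) (fun c (n : N) => c *: n) b.
Proof. by split. Qed.
Lemma tensor_liftE m n : tensor_lift b (m ⊗ n) = b m n.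
Proof. exact: tliftE. Qed.
Lemma tensor_liftD : {morph tensor_lift b : x y / x + y}.
Proof. by move=> x y; apply: tliftD. Qed.
End Lift.

Lemma tensor_lift_linear (M N V : lmodType k) (b : M -> N -> V) :
  (forall n, linear (b^~ n)) -> (forall m, linear (b m)) ->
  linear (tensor_lift b).
Proof.
move=> bl br.
have bD1 m m' n : b (m + m') n = b m n + b m' n by rewrite (linD (bl n)).
have bD2 m n n' : b m (n + n') = b m n + b m n' by rewrite (linD (br m)).
have bB c m n : b (c *: m) n = b m (c *: n) by rewrite (linZ (bl n)) (linZ (br m)).
have LD := tensor_liftD bD1 bD2 bB.
apply: linearP_pred => // c; apply: tensor_ext => [x y|x y|m n].
- by rewrite scalerDr LD.
- by rewrite LD scalerDr.
by rewrite -tensorZl !tensor_liftE // (linZ (bl n)).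
Qed.

Lemma tensor_lift_linearE (M N V : lmodType k) (b : M -> N -> V) m n :
  (forall n, linear (b^~ n)) -> (forall m, linear (b m)) ->
  tensor_lift b (m ⊗ n) = b m n.
Proof.
move=> bl br; apply: tensor_liftE => *; rewrite ?(linD (bl _)) ?(linD (br _)) //.
by rewrite (linZ (bl _)) (linZ (br _)).
Qed.

Lemma pure_linl (M N : lmodType k) (n : N) : linear (fun m : M => m ⊗ n).
Proof. by move=> c x y; rewrite tensorDl tensorZl. Qed.
Lemma pure_linr (M N : lmodType k) (m : M) : linear (fun n : N => m ⊗ n).
Proof. by move=> c x y; rewrite tensorDr tensorZr. Qed.

Section Map.
Variables (M N M' N' : lmodType k) (f : M -> M') (g : N -> N').
Hypotheses (fL : linear f) (gL : linear g).
Let l1 n : linear (fun m => f m ⊗ g n).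
Proof. by move=> c x y; rewrite fL pure_linl. Qed.
Let l2 m : linear (fun n => f m ⊗ g n).
Proof. by move=> c x y; rewrite gL pure_linr. Qed.
Lemma tensor_mapE m n : tensor_map f g (m ⊗ n) = f m ⊗ g n.
Proof. exact: tensor_lift_linearE. Qed.
Lemma tensor_map_linear : linear (tensor_map f g).
Proof. exact: tensor_lift_linear. Qed.
End Map.

Section Assoc.
Variables (M N P : lmodType k).
Let l1 (m : M) (p : P) : linear (fun n : N => (m ⊗ n) ⊗ p).
Proof. by move=> c x y; rewrite pure_linr pure_linl. Qed.
Let l2 (m : M) (n : N) : linear (fun p : P => (m ⊗ n) ⊗ p).
Proof. exact: pure_linr. Qed.
Let L2 m : linear (tensor_lift (fun (n : N) (p : P) => (m ⊗ n : tensor M N) ⊗ p)).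
Proof. exact: tensor_lift_linear. Qed.
Let L1 x : linear
  (fun m => tensor_lift (fun (n : N) (p : P) => (m ⊗ n : tensor M N) ⊗ p) x).
Proof.
move=> c m m'; move: x; apply: tensor_ext => [x y|x y|n p].
- exact: linD.
- by rewrite !(linD (L2 _)) scalerDr addrACA.
- by rewrite !tensor_lift_linearE // pure_linl pure_linl.
Qed.
Lemma tensor_assoc_linear : linear (@tensor_assoc M N P).
Proof. exact: tensor_lift_linear. Qed.
Lemma tensor_assocE m n p :
  tensor_assoc (m ⊗ (n ⊗ p : tensor N P)) = (m ⊗ n : tensor M N) ⊗ p.
Proof. by rewrite /tensor_assoc !tensor_lift_linearE. Qed.
End Assoc.

Lemma tensor_mapD (M N M' N' : lmodType k) (f : M -> M') (g : N -> N') :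
  linear f -> linear g -> {morph tensor_map f g : x y / x + y}.
Proof. by move=> fL gL; apply/linD/tensor_map_linear. Qed.

Lemma tensor_assocD (M N P : lmodType k) :
  {morph @tensor_assoc M N P : x y / x + y}.
Proof. exact/linD/tensor_assoc_linear. Qed.

End TensorOps.

Section Hopf.
Variable k : fieldType.

(* Sweedler sums such as h_(1) x h_(2) are tensor_lift of the corresponding   *)
(* bilinear map, applied to comul h.                                          *)
Record hopfAlg := HopfAlg {
  hopf_sort :> algType k;
  comul : hopf_sort -> tensor hopf_sort hopf_sort;
  counit : hopf_sort -> k;
  antipode : hopf_sort -> hopf_sort;
  comul_linear : linear comul;
  comul_monoid : monoid_morphism comul;
  counit_linear : scalar counit;
  counit_monoid : monoid_morphism counit;
  antipode_linear : linear antipode;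
  comulA : forall h,
    tensor_map comul id (comul h) = tensor_assoc (tensor_map id comul (comul h));
  counit_l : forall h,
    tensor_lift (fun h1 h2 => counit h1 *: h2) (comul h) = h;
  counit_r : forall h,
    tensor_lift (fun h1 h2 => counit h2 *: h1) (comul h) = h;
  antipode_l : forall h,
    tensor_lift (fun h1 h2 => antipode h1 * h2) (comul h) = (counit h)%:A;
  antipode_r : forall h,
    tensor_lift (fun h1 h2 => h1 * antipode h2) (comul h) = (counit h)%:A
}.

Variable H : hopfAlg.

Record comodAlg := ComodAlg {
  comod_sort :> algType k;
  coact : comod_sort -> tensor comod_sort H;
  coact_linear : linear coact;
  coact_monoid : monoid_morphism coact;
  coactA : forall a,
    tensor_map coact id (coact a) = tensor_assoc (tensor_map id (@comul H) (coact a));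
  coact_counit : forall a,
    tensor_lift (fun a0 h => counit h *: a0) (coact a) = a
}.

(* No linearity over the coinvariants is required. *)
Definition comodAlg_iso (A A' : comodAlg) : Prop :=
  exists F : {lrmorphism A -> A'},
    bijective F /\ forall a, coact (F a) = tensor_map F id (coact a).

End Hopf.

Arguments comul_linear {k} h : rename.
Arguments comul_monoid {k} h : rename.
Arguments counit_linear {k} h : rename.
Arguments counit_monoid {k} h : rename.
Arguments antipode_linear {k} h : rename.
Arguments coact_linear {k H} c : rename.
Arguments coact_monoid {k H} c : rename.

Section FaithfullyFlat.

Definition exact_at (U V W : zmodType) (f : U -> V) (g : V -> W) : Prop :=
  forall y, g y = 0 <-> exists x, f x = y.

(* N is a C-module through la; - ⊗_C N preserves and reflects exactness. *)
Definition faithfully_flat (C : comNzRingType) (N : zmodType)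
    (la : C -> N -> N) : Prop :=
  forall (M1 M2 M3 : lmodType C)
         (f : {linear M1 -> M2}) (g : {linear M2 -> M3}),
  let tensN (M : lmodType C) := tens (fun (m : M) (c : C) => c *: m) la in
  exact_at f g <->
  exact_at (tmap f id : tensN M1 -> tensN M2) (tmap g id : tensN M2 -> tensN M3).

End FaithfullyFlat.

Section Bundle.
Variables (k : fieldType) (H : hopfAlg k).

(* a ⊗ b |-> (a ⊗ 1) * coact b, on the tensor product over the subalgebra j(C). *)
Definition galois_map (C : comAlgType k) (A : comodAlg H) (j : C -> A) :
    tens (fun (a : A) (c : C) => a * j c) (fun (c : C) (b : A) => j c * b) ->
    tensor A H :=
  tlift (fun a b => (a ⊗ 1) * coact b).

(* The base C is a separate type, identified by the injection base with the   *)
(* subalgebra of coinvariants.                                                *)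
Record bundle (C : comAlgType k) := Bundle {
  total :> comodAlg H;
  base : {lrmorphism C -> total};
  base_inj : injective base;
  base_coinv : forall a : total, coact a = a ⊗ 1 <-> exists c, base c = a;
  base_central : forall c (a : total), base c * a = a * base c;
  base_galois : bijective (@galois_map C total base);
  base_flat : faithfully_flat (fun c (a : total) => base c * a)
}.

End Bundle.

(* C' as a C-module through f; f is kept in the type so that the module       *)
(* structure can be inferred.                                                 *)
Section Restr.
Variables (C C' : comNzRingType) (f : {rmorphism C -> C'}).
Definition restr_scalars : Type := let _ := f in C'.
HB.instance Definition _ := GRing.Zmodule.copy restr_scalars C'.
Let sc (c : C) (x : restr_scalars) : restr_scalars := (f c * x : C').
Let scA a b v : sc a (sc b v) = sc (a * b) v.
Proof. by rewrite /sc rmorphM mulrA. Qed.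
Let sc1 : left_id 1 sc.
Proof. by move=> x; rewrite /sc rmorph1 mul1r. Qed.
Let scDr : right_distributive sc +%R.
Proof. by move=> c x y; rewrite /sc; apply: mulrDr. Qed.
Let scDl v : {morph sc^~ v: a b / a + b}.
Proof. by move=> a b; rewrite /sc rmorphD; apply: mulrDl. Qed.
HB.instance Definition _ :=
  GRing.Zmodule_isLmodule.Build C restr_scalars scA sc1 scDr scDl.
End Restr.

Section Pushforward.
Variables (k : fieldType) (H : hopfAlg k) (C C' : comAlgType k).
Variables (f : {lrmorphism C -> C'}) (A : bundle H C).

Local Notation ra := (fun (c' : C') (c : C) => f c * c').
Local Notation la := (fun (c : C) (a : A) => base A c * a).

(* C' ⊗_C A. *)
Definition pushfwd : Type := tens ra la.
HB.instance Definition _ := GRing.Zmodule.on pushfwd.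

Definition pf_pure (c' : C') (a : A) : pushfwd := tpure c' a.

Let raMl (x y : C') r : ra (x * y) r = ra x r * y. Proof. exact: mulrA. Qed.
Let raMr (x y : C') r : ra (x * y) r = x * ra y r. Proof. exact: mulrCA. Qed.
Let laMl r (x y : A) : la r (x * y) = la r x * y. Proof. exact: mulrA. Qed.
Let laMr r (x y : A) : la r (x * y) = x * la r y.
Proof. by rewrite /= !mulrA base_central. Qed.

HB.instance Definition _ := GRing.Zmodule_isPzRing.Build pushfwd
  (tmulA raMl raMr laMl laMr) (tmul1l raMl raMr laMl laMr)
  (tmul1r raMl raMr laMl laMr) (tmulDl raMl raMr laMl laMr)
  (tmulDr raMl raMr laMl laMr).

Lemma pf_pureM x a y b : pf_pure x a * pf_pure y b = pf_pure (x * y) (a * b).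
Proof. exact: (tmul_pure raMl raMr laMl laMr). Qed.
Lemma pf_pureDl x y a : pf_pure (x + y) a = pf_pure x a + pf_pure y a.
Proof. exact: tpureDl. Qed.
Lemma pf_pureDr x a b : pf_pure x (a + b) = pf_pure x a + pf_pure x b.
Proof. exact: tpureDr. Qed.
Lemma pf_bal c x a : pf_pure (f c * x) a = pf_pure x (base A c * a).
Proof. exact: (@tpure_bal _ _ _ ra la). Qed.
Lemma pf_ind (P : pushfwd -> Prop) :
  P 0 -> (forall x a, P (pf_pure x a)) ->
  (forall x y, P x -> P y -> P (x + y)) -> forall x, P x.
Proof. exact: tens_ind. Qed.
Lemma pf_ext (V : zmodType) (u v : pushfwd -> V) :
  {morph u : x y / x + y} -> {morph v : x y / x + y} ->
  (forall x a, u (pf_pure x a) = v (pf_pure x a)) -> u =1 v.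
Proof. exact: tens_ext. Qed.

(* If C' ⊗ A were zero then, A being faithfully flat, C' would be zero. *)
Lemma pf_oner_neq0 : 1 != 0 :> pushfwd.
Proof.
apply/eqP => P10.
have P0 (x : pushfwd) : x = 0 by rewrite -[x]mulr1 P10 mulr0.
have ff := @base_flat _ _ _ A (restr_scalars f) (restr_scalars f)
  (restr_scalars f) (\0 : {linear _ -> _}) (\0 : {linear _ -> _}).
have [_ ex] := ff.
have : @exact_at (restr_scalars f) (restr_scalars f) (restr_scalars f) \0 \0.
  apply: ex => y; split=> _; last exact: P0.
  by exists 0; rewrite [RHS]P0; apply: P0.
move=> /(_ (1 : C')) [/(_ erefl) [x x1] _].
by have /eqP := x1 : (0 : C') = 1; rewrite eq_sym oner_eq0.
Qed.
HB.instance Definition _ := GRing.PzSemiRing_isNonZero.Build pushfwd pf_oner_neq0.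

Definition pf_scale (c : k) : pushfwd -> pushfwd :=
  tlift (fun x a => pf_pure (c *: x) a).

Let sbal c : balanced ra la (fun x a => pf_pure (c *: x) a).
Proof.
split=> [x y a|x a b|x r a]; first by rewrite scalerDr pf_pureDl.
  exact: pf_pureDr.
by rewrite scalerAr pf_bal.
Qed.
Lemma pf_scaleE c x a : pf_scale c (pf_pure x a) = pf_pure (c *: x) a.
Proof. exact: tliftE. Qed.
Lemma pf_scaleDr : right_distributive pf_scale +%R.
Proof. by move=> c x y; apply: tliftD. Qed.
Lemma pf_scaleA a b v : pf_scale a (pf_scale b v) = pf_scale (a * b) v.
Proof.
move: v; apply: pf_ext => [x y|x y|x c]; rewrite ?pf_scaleDr //.
by rewrite !pf_scaleE scalerA.
Qed.
Lemma pf_scale1 : left_id 1 pf_scale.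
Proof.
apply: pf_ext => [x y|x y|x c]; rewrite ?pf_scaleDr //.
by rewrite pf_scaleE scale1r.
Qed.
Lemma pf_scaleDl v : {morph pf_scale^~ v : a b / a + b}.
Proof.
move=> a b; move: v; apply: pf_ext => [x y|x y|x c].
- by rewrite pf_scaleDr.
- by rewrite !pf_scaleDr addrACA.
- by rewrite !pf_scaleE scalerDl pf_pureDl.
Qed.
HB.instance Definition _ := GRing.Zmodule_isLmodule.Build k pushfwd
  pf_scaleA pf_scale1 pf_scaleDr pf_scaleDl.

Lemma pf_pureZl c x a : pf_pure (c *: x) a = c *: pf_pure x a.
Proof. by rewrite -pf_scaleE. Qed.
Lemma pf_pureZr c x a : pf_pure x (c *: a) = c *: pf_pure x a.
Proof.
rewrite -pf_pureZl -[c *: a]mul1r -scalerAr scalerAl -(rmorph1 (base A)) -linearZ.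
by rewrite -pf_bal linearZ rmorph1 -scalerAl mul1r.
Qed.

Lemma pf_scaleAl c (u v : pushfwd) : c *: (u * v) = (c *: u) * v.
Proof.
elim/pf_ind: u => [|a b|x x' IHx IHx']; first by rewrite scaler0 !mul0r scaler0.
  elim/pf_ind: v => [|a' b'|y y' IHy IHy']; first by rewrite !mulr0 scaler0.
    by rewrite -pf_pureZl !pf_pureM -pf_pureZl scalerAl.
  by rewrite !mulrDr scalerDr IHy IHy'.
by rewrite !(scalerDr, mulrDl) IHx IHx'.
Qed.
HB.instance Definition _ := GRing.Lmodule_isLalgebra.Build k pushfwd pf_scaleAl.
Lemma pf_scaleAr c (u v : pushfwd) : c *: (u * v) = u * (c *: v).
Proof.
elim/pf_ind: u => [|a b|x x' IHx IHx']; first by rewrite !mul0r scaler0.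
  elim/pf_ind: v => [|a' b'|y y' IHy IHy']; first by rewrite scaler0 !mulr0 scaler0.
    by rewrite -pf_pureZl !pf_pureM -pf_pureZl scalerAr.
  by rewrite !(mulrDr, scalerDr) IHy IHy'.
by rewrite !(scalerDr, mulrDl) IHx IHx'.
Qed.
HB.instance Definition _ := GRing.Lalgebra_isAlgebra.Build k pushfwd pf_scaleAr.

(* id ⊗ coact, followed by C' ⊗_C (A ⊗ H) ~ (C' ⊗_C A) ⊗ H. *)
Definition pf_coact : pushfwd -> tensor pushfwd H :=
  tlift (fun x a => tensor_map (pf_pure x) id (coact a)).

Lemma pf_pure_linear x : linear (pf_pure x).
Proof. by move=> c a b; rewrite pf_pureDr pf_pureZr. Qed.
Local Notation E x := (tensor_map (pf_pure x) (id : H -> H)).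
Let id_linear (V : lmodType k) : linear (id : V -> V). Proof. by []. Qed.
Let EE x a h : E x (a ⊗ h) = pf_pure x a ⊗ h.
Proof. by rewrite tensor_mapE //; apply: pf_pure_linear. Qed.
Let ED x : {morph E x : u v / u + v}.
Proof. by apply: tensor_mapD => //; apply: pf_pure_linear. Qed.
Let EDl x y u : E (x + y) u = E x u + E y u.
Proof.
move: u; apply: tensor_ext => [u v|u v|a h]; rewrite ?ED //.
  by rewrite addrACA.
by rewrite !EE pf_pureDl tensorDl.
Qed.
Let EM x y u v : E (x * y) (u * v) = E x u * E y v.
Proof.
elim/tensor_ind: u => [|a h|u u' IHu IHu'];
  first by rewrite mul0r !(morphD0 (ED _)) mul0r.
  elim/tensor_ind: v => [|b g|v v' IHv IHv'].
  - by rewrite mulr0 !(morphD0 (ED _)) mulr0.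
  - by rewrite tensorM !EE tensorM pf_pureM.
  - by rewrite !(mulrDr, ED) IHv IHv'.
by rewrite !(mulrDl, ED) IHu IHu'.
Qed.

Let coactD : {morph @coact _ _ A : u v / u + v}.
Proof. exact/linD/coact_linear. Qed.
Let coactM (a b : A) : coact (a * b) = coact a * coact b.
Proof. by case: (coact_monoid A) => _ ->. Qed.

Let coact_bal : balanced ra la (fun x a => E x (coact a)).
Proof.
split=> [x y a|x a b|x r a]; first exact: EDl.
  by rewrite coactD ED.
rewrite coactM; have /base_coinv -> : exists c, base A c = base A r by exists r.
move: (coact a); apply: tensor_ext => [u v|u v|b h].
- exact: ED.
- by rewrite mulrDr ED.
- by rewrite tensorM !EE pf_bal mul1r.
Qed.

Lemma pf_coactE x a : pf_coact (pf_pure x a) = tensor_map (pf_pure x) id (coact a).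
Proof. exact: tliftE. Qed.
Let pf_coactD : {morph pf_coact : u v / u + v}.
Proof. by move=> u v; apply: tliftD. Qed.

Lemma pf_coact_linear : linear pf_coact.
Proof.
apply: linearP_pred => // c; apply: pf_ext => [u v|u v|x a].
- by rewrite scalerDr pf_coactD.
- by rewrite pf_coactD scalerDr.
rewrite -pf_pureZr !pf_coactE (linZ (coact_linear A)) linZ //.
by apply: tensor_map_linear => //; apply: pf_pure_linear.
Qed.

Lemma pf_coact_monoid : monoid_morphism pf_coact.
Proof.
split; first by rewrite [1]/(pf_pure 1 1) pf_coactE (coact_monoid A).1 EE.
move=> u v; elim/pf_ind: u => [|x a|u u' IHu IHu'];
  first by rewrite mul0r !(morphD0 pf_coactD) mul0r.
  elim/pf_ind: v => [|y b|v v' IHv IHv'].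
  - by rewrite mulr0 !(morphD0 pf_coactD) mulr0.
  - by rewrite pf_pureM !pf_coactE coactM EM.
  - by rewrite !(mulrDr, pf_coactD) IHv IHv'.
by rewrite !(mulrDl, pf_coactD) IHu IHu'.
Qed.

Let comulL := comul_linear H.
Let pfcoL := pf_coact_linear.

Lemma pf_coactA u :
  tensor_map pf_coact id (pf_coact u) =
  tensor_assoc (tensor_map id (@comul _ H) (pf_coact u)).
Proof.
have L1 : {morph tensor_map pf_coact (id : H -> H) : x y / x + y}.
  exact: tensor_mapD.
have L2 : {morph tensor_map (id : pushfwd -> pushfwd) (@comul _ H) : x y / x + y}.
  exact: tensor_mapD.
move: u; apply: pf_ext => [u v|u v|x a].
- by rewrite pf_coactD L1.
- by rewrite pf_coactD L2; apply: tensor_assocD.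
rewrite pf_coactE.
have EL : linear (E x) by apply: tensor_map_linear => //; apply: pf_pure_linear.
have L3 : {morph tensor_map (E x) (id : H -> H) : u v / u + v}.
  exact: tensor_mapD.
have -> : tensor_map pf_coact id (E x (coact a)) =
          tensor_map (E x) id (tensor_map (@coact _ _ A) id (coact a)).
  move: (coact a); apply: tensor_ext => [u v|u v|b h].
  - by rewrite ED L1.
  - by rewrite tensor_mapD ?L3 //; apply: coact_linear.
  - rewrite EE !tensor_mapE ?pf_coactE //; exact: coact_linear.
rewrite coactA.
have L4 : {morph tensor_map (id : A -> A) (@comul _ H) : x y / x + y}.
  exact: tensor_mapD.
move: (coact a); apply: tensor_ext => [u v|u v|b h].
- by rewrite L4 -L3; congr tensor_map; apply: tensor_assocD.
- by rewrite ED L2; apply: tensor_assocD.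
rewrite EE !tensor_mapE //.
move: (comul h); apply: tensor_ext => [u v|u v|h1 h2].
- by rewrite tensorDr -L3; congr tensor_map; apply: tensor_assocD.
- by rewrite tensorDr; apply: tensor_assocD.
- by rewrite !tensor_assocE tensor_mapE // EE.
Qed.

Lemma pf_coact_counit u :
  tensor_lift (fun a0 h => counit h *: a0) (pf_coact u) = u.
Proof.
have cL : linear (@counit _ H : H -> k^o) := counit_linear H.
have cZ c h : counit (c *: h : H) = c * counit h := linZ cL c h.
have cD (g h : H) : counit (g + h) = counit g + counit h := linD cL g h.
have bl (V : lmodType k) (h : H) : linear (fun v : V => counit h *: v).
  by move=> c v w; rewrite scalerDr !scalerA mulrC.
have br (V : lmodType k) (v : V) : linear (fun h : H => counit h *: v).
  by move=> c g h; rewrite cD cZ scalerDl scalerA.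
have L (V : lmodType k) :
    {morph tensor_lift (fun (a0 : V) (h : H) => counit h *: a0) : x y / x + y}.
  by apply/linD/tensor_lift_linear.
move: u; apply: pf_ext => [u v|u v|x a] //.
  by rewrite pf_coactD L.
rewrite pf_coactE -[in RHS](coact_counit a).
have PD := linD (pf_pure_linear x).
move: (coact a); apply: tensor_ext => [u v|u v|b h].
- by rewrite ED L.
- by rewrite L PD.
- by rewrite EE !tensor_lift_linearE // pf_pureZr.
Qed.

Definition pushforward : comodAlg H :=
  ComodAlg pf_coact_linear pf_coact_monoid pf_coactA pf_coact_counit.

End Pushforward.

Section Trivial.
Variables (k : fieldType) (H : hopfAlg k) (C : algType k).

Let cD (g h : H) : counit (g + h) = counit g + counit h.
Proof. exact: (linD (counit_linear H : linear (@counit _ H : H -> k^o))). Qed.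
Let cZ c (h : H) : counit (c *: h) = c * counit h.
Proof. exact: (linZ (counit_linear H : linear (@counit _ H : H -> k^o))). Qed.
Let bl (V : lmodType k) (h : H) : linear (fun v : V => counit h *: v).
Proof. by move=> c v w; rewrite scalerDr !scalerA mulrC. Qed.
Let br (V : lmodType k) (v : V) : linear (fun h : H => counit h *: v).
Proof. by move=> c g h; rewrite cD cZ scalerDl scalerA. Qed.

(* The counit of H makes A ⊗ H nonzero for every (nonzero) algebra A. *)
Lemma triv_oner_neq0 : 1 != 0 :> (tensor C H).
Proof.
apply/eqP => /(congr1 (tensor_lift (fun (c : C) (h : H) => counit h *: c))).
rewrite tensor_lift_linearE // (counit_monoid H).1 scale1r.
rewrite (morphD0 (linD (tensor_lift_linear _ _))) //.
by apply/eqP; rewrite oner_eq0.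
Qed.
HB.instance Definition _ :=
  GRing.PzSemiRing_isNonZero.Build (tensor C H) triv_oner_neq0.
HB.instance Definition _ := GRing.Lmodule_isLalgebra.Build k (tensor C H)
  (@tensorZAl k C H).
HB.instance Definition _ := GRing.Lalgebra_isAlgebra.Build k (tensor C H)
  (@tensorZAr k C H).

(* id ⊗ comul, followed by C ⊗ (H ⊗ H) ~ (C ⊗ H) ⊗ H. *)
Definition triv_coact (x : (tensor C H)) : tensor (tensor C H) H :=
  tensor_assoc (tensor_map id (@comul _ H) x).

Let idL (V : lmodType k) : linear (id : V -> V). Proof. by []. Qed.
Let comulL := comul_linear H.
Let mapL : linear (tensor_map (id : C -> C) (@comul _ H)).
Proof. exact: tensor_map_linear. Qed.

Lemma triv_coact_linear : linear triv_coact.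
Proof.
move=> c x y; rewrite /triv_coact mapL; exact: tensor_assoc_linear.
Qed.
Let tD := linD triv_coact_linear.

Definition triv_pure (e : C) (w : tensor H H) : tensor (tensor C H) H :=
  tensor_assoc (e ⊗ w).
Local Notation T := triv_pure.

Lemma triv_coactE (c : C) (h : H) :
  triv_coact (c ⊗ h) = T c (comul h).
Proof. by rewrite /triv_coact tensor_mapE. Qed.

Let assocM (c d : C) (u v : tensor H H) : T (c * d) (u * v) = T c u * T d v.
Proof.
have TD e : {morph T e : u v / u + v}.
  by move=> x y; rewrite /triv_pure tensorDr; apply: tensor_assocD.
have TE e (g h : H) : T e (g ⊗ h) = (e ⊗ g : (tensor C H)) ⊗ h.
  by rewrite /triv_pure tensor_assocE.
elim/tensor_ind: u => [|g h|u u' IHu IHu'];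
  first by rewrite mul0r !(morphD0 (TD _)) mul0r.
  elim/tensor_ind: v => [|g' h'|v v' IHv IHv'].
  - by rewrite mulr0 !(morphD0 (TD _)) mulr0.
  - by rewrite tensorM !TE [RHS]tensorM; congr (_ ⊗ _); rewrite [RHS]tensorM.
  - by rewrite !(mulrDr, TD) IHv IHv'.
by rewrite !(mulrDl, TD) IHu IHu'.
Qed.

Lemma triv_coact_monoid : monoid_morphism triv_coact.
Proof.
split.
  rewrite [1](_ : _ = (1 : C) ⊗ (1 : H)) // triv_coactE (comul_monoid H).1.
  by rewrite (_ : 1 = 1 ⊗ 1 :> tensor H H) // /triv_pure tensor_assocE.
move=> u v; elim/tensor_ind: u => [|x a|u u' IHu IHu'];
  first by rewrite mul0r !(morphD0 tD) mul0r.
  elim/tensor_ind: v => [|y b|v v' IHv IHv'].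
  - by rewrite mulr0 !(morphD0 tD) mulr0.
  - rewrite [_ * _](_ : _ = (x * y) ⊗ (a * b)); last exact: tensorM.
    by rewrite !triv_coactE (comul_monoid H).2 assocM.
  - by rewrite mulrDr !tD mulrDr IHv IHv'.
by rewrite mulrDl !tD mulrDl IHu IHu'.
Qed.

Lemma triv_coactA u :
  tensor_map triv_coact id (triv_coact u) =
  tensor_assoc (tensor_map id (@comul _ H) (triv_coact u)).
Proof.
have cL := triv_coact_linear.
have L1 : {morph tensor_map triv_coact (id : H -> H) : x y / x + y}.
  exact: tensor_mapD.
have L2 : {morph tensor_map (id : (tensor C H) -> (tensor C H)) (@comul _ H) : x y / x + y}.
  exact: tensor_mapD.
move: u; apply: tensor_ext => [u v|u v|x a].
- by rewrite tD L1.
- by rewrite tD L2; apply: tensor_assocD.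
rewrite triv_coactE.
have TD : {morph T x : u v / u + v}.
  by move=> w y; rewrite /triv_pure tensorDr; apply: tensor_assocD.
have TL : linear (T x).
  move=> c w y; rewrite /triv_pure.
  by rewrite (pure_linr x c w y); apply: tensor_assoc_linear.
have TE (g h : H) : T x (g ⊗ h) = (x ⊗ g : (tensor C H)) ⊗ h.
  by rewrite /triv_pure tensor_assocE.
have L3 : {morph tensor_map (T x) (id : H -> H) : u v / u + v} by exact: tensor_mapD.
have -> : tensor_map triv_coact id (T x (comul a)) =
          tensor_map (T x) id (tensor_map (@comul _ H) id (comul a)).
  move: (comul a); apply: tensor_ext => [u v|u v|b h].
  - by rewrite TD L1.
  - by rewrite tensor_mapD ?L3.
  - by rewrite TE !tensor_mapE ?triv_coactE.
rewrite comulA.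
have L4 : {morph tensor_map (id : H -> H) (@comul _ H) : x y / x + y}.
  exact: tensor_mapD.
move: (comul a); apply: tensor_ext => [u v|u v|b h].
- by rewrite L4 -L3; congr tensor_map; apply: tensor_assocD.
- by rewrite TD L2; apply: tensor_assocD.
rewrite TE !tensor_mapE //.
move: (comul h); apply: tensor_ext => [u v|u v|h1 h2].
- by rewrite tensorDr -L3; congr tensor_map; apply: tensor_assocD.
- by rewrite tensorDr; apply: tensor_assocD.
- by rewrite !tensor_assocE tensor_mapE // TE.
Qed.

Lemma triv_coact_counit u :
  tensor_lift (fun a0 h => counit h *: a0) (triv_coact u) = u.
Proof.
have L (V : lmodType k) :
    {morph tensor_lift (fun (a0 : V) (h : H) => counit h *: a0) : x y / x + y}.
  by apply/linD/tensor_lift_linear.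
move: u; apply: tensor_ext => [u v|u v|x a] //.
  by rewrite tD L.
rewrite triv_coactE -[in RHS](counit_r a).
move: (comul a); apply: tensor_ext => [u v|u v|b h].
- rewrite /triv_pure tensorDr -L; congr tensor_lift; exact: tensor_assocD.
- by rewrite L tensorDr.
- by rewrite /triv_pure tensor_assocE !tensor_lift_linearE // tensorZr.
Qed.

Definition trivial_comodAlg : comodAlg H :=
  ComodAlg triv_coact_linear triv_coact_monoid triv_coactA triv_coact_counit.

End Trivial.

(* C[t] as a k-algebra; the library only has it as a C-algebra. *)
Section PolyAlg.
Variables (k : comNzRingType) (C : comAlgType k).

Definition polyAlg : Type := {poly C}.
HB.instance Definition _ := GRing.ComNzRing.on polyAlg.

Let sc (c : k) (p : polyAlg) : polyAlg := (c%:A : C) *: (p : {poly C}).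
Let scA a b v : sc a (sc b v) = sc (a * b) v.
Proof. by rewrite /sc scalerA mulr_algl scalerA. Qed.
Let sc1 : left_id 1 sc.
Proof. by move=> x; rewrite /sc !scale1r. Qed.
Let scDr : right_distributive sc +%R.
Proof. by move=> c x y; apply: scalerDr. Qed.
Let scDl v : {morph sc^~ v: a b / a + b}.
Proof. by move=> a b; rewrite /sc scalerDl; apply: scalerDl. Qed.
HB.instance Definition _ :=
  GRing.Zmodule_isLmodule.Build k polyAlg scA sc1 scDr scDl.
Let scAl (c : k) (u v : polyAlg) : c *: (u * v) = (c *: u) * v.
Proof. exact: (@scalerAl C {poly C}). Qed.
HB.instance Definition _ := GRing.Lmodule_isLalgebra.Build k polyAlg scAl.
HB.instance Definition _ := GRing.Lalgebra_isComAlgebra.Build k polyAlg.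

Variable x : C.
Definition poly_ev (p : polyAlg) : C := (p : {poly C}).[x].
Let ev_linear : linear poly_ev.
Proof. by move=> c p q; rewrite /poly_ev hornerD hornerZ mulr_algl. Qed.
HB.instance Definition _ := GRing.isLinear.Build k polyAlg C *:%R poly_ev ev_linear.
Let ev_monoid : monoid_morphism poly_ev.
Proof. by split=> [|p q]; rewrite /poly_ev (hornerC, hornerM). Qed.
HB.instance Definition _ := GRing.isMonoidMorphism.Build polyAlg C poly_ev ev_monoid.
End PolyAlg.

Section Etale.
Variables (C D : comNzRingType) (f : {rmorphism C -> D}).

Definition finite_morph : Prop :=
  exists (n : nat) (e : 'I_n -> D),
    forall d, exists c : 'I_n -> C, d = \sum_i f (c i) * e i.

(* As an algebra: D is C[x_1, ..., x_n] / (r_1, ..., r_m). *)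
Definition finitely_presented : Prop :=
  exists (n : nat) (v : 'I_n -> D),
    (forall d, exists p : {mpoly C[n]}, mmap f v p = d) /\
    exists (m : nat) (r : 'I_m -> {mpoly C[n]}),
      forall p : {mpoly C[n]},
        mmap f v p = 0 <-> exists q : 'I_m -> {mpoly C[n]}, p = \sum_i q i * r i.

(* Unique lifting along square-zero extensions p : S -> T of C-algebras.      *)
(* Discarding zero rings is harmless: if T = 0 then ker p = S has square      *)
(* zero, hence S = 0.                                                         *)
Definition formally_etale : Prop :=
  forall (S T : comNzRingType) (p : {rmorphism S -> T}),
    (forall t, exists s, p s = t) ->
    (forall x y, p x = 0 -> p y = 0 -> x * y = 0) ->
  forall (g : {rmorphism C -> S}) (h : {rmorphism D -> T}),
    p \o g =1 h \o f ->
    exists u : {rmorphism D -> S},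
      [/\ u \o f =1 g, p \o u =1 h &
          forall u' : {rmorphism D -> S}, u' \o f =1 g -> p \o u' =1 h -> u' =1 u].

Definition etale : Prop := formally_etale /\ finitely_presented.
Definition finite_etale : Prop := finite_morph /\ etale.

End Etale.

Section Homotopy.
Variables (k : fieldType) (H : hopfAlg k) (C : comAlgType k).

Definition homotopic (A A' : bundle H C) : Prop :=
  exists (Cb : comAlgType k) (i : {lrmorphism C -> Cb})
         (B : bundle H (polyAlg Cb)),
    [/\ finite_etale i,
        comodAlg_iso (pushforward (@poly_ev k Cb 0) B) (pushforward i A) &
        comodAlg_iso (pushforward (@poly_ev k Cb 1) B) (pushforward i A')].

Definition homotopy_equivalent : bundle H C -> bundle H C -> Prop :=
  Relation_Operators.clos_refl_sym_trans (bundle H C) homotopic.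

Definition trivial_bundle (A : bundle H C) : Prop :=
  comodAlg_iso A (trivial_comodAlg H C).

Definition homotopically_trivial (A : bundle H C) : Prop :=
  exists T : bundle H C, trivial_bundle T /\ homotopy_equivalent A T.

Definition cleft (A : comodAlg H) : Prop :=
  exists (gamma gamma' : {linear H -> A}),
    [/\ forall h, coact (gamma h) = tensor_map gamma id (comul h),
        forall h, tensor_lift (fun h1 h2 => gamma h1 * gamma' h2) (comul h) =
                  (counit h)%:A &
        forall h, tensor_lift (fun h1 h2 => gamma' h1 * gamma h2) (comul h) =
                  (counit h)%:A].

End Homotopy.

Section Sweedler.
Variable k : fieldType.

(* H4_elt a0 a1 a2 a3 stands for a0 + a1 X + a2 Y + a3 XY. *)
Record H4 : Type := H4_elt { H4_c1 : k; H4_cX : k; H4_cY : k; H4_cXY : k }.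

Definition H4_code (a : H4) : k * k * k * k :=
  let: H4_elt a0 a1 a2 a3 := a in (a0, a1, a2, a3).
Definition H4_decode (c : k * k * k * k) : H4 :=
  let: (a0, a1, a2, a3) := c in H4_elt a0 a1 a2 a3.
Lemma H4_codeK : cancel H4_code H4_decode. Proof. by case. Qed.
HB.instance Definition _ := Choice.copy H4 (can_type H4_codeK).

Definition H4_add (a b : H4) : H4 :=
  let: H4_elt a0 a1 a2 a3 := a in
  let: H4_elt b0 b1 b2 b3 := b in
  H4_elt (a0 + b0) (a1 + b1) (a2 + b2) (a3 + b3).
Definition H4_opp (a : H4) : H4 :=
  let: H4_elt a0 a1 a2 a3 := a in H4_elt (- a0) (- a1) (- a2) (- a3).
Definition H4_scale (c : k) (a : H4) : H4 :=
  let: H4_elt a0 a1 a2 a3 := a in H4_elt (c * a0) (c * a1) (c * a2) (c * a3).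

(* Extended bilinearly from X X = 1, Y Y = 0 and Y X = - X Y. *)
Definition H4_mul (a b : H4) : H4 :=
  let: H4_elt a0 a1 a2 a3 := a in
  let: H4_elt b0 b1 b2 b3 := b in
  H4_elt (a0 * b0 + a1 * b1)
         (a0 * b1 + a1 * b0)
         (a0 * b2 + a1 * b3 + a2 * b0 - a3 * b1)
         (a0 * b3 + a1 * b2 + a3 * b0 - a2 * b1).

Lemma H4_eq (a0 a1 a2 a3 b0 b1 b2 b3 : k) :
  a0 = b0 -> a1 = b1 -> a2 = b2 -> a3 = b3 ->
  H4_elt a0 a1 a2 a3 = H4_elt b0 b1 b2 b3.
Proof. by move=> -> -> -> ->. Qed.

Lemma H4_addA : associative H4_add.
Proof. by move=> [????] [????] [????]; apply: H4_eq; rewrite addrA. Qed.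
Lemma H4_addC : commutative H4_add.
Proof. by move=> [????] [????]; apply: H4_eq; rewrite addrC. Qed.
Lemma H4_add0 : left_id (H4_elt 0 0 0 0) H4_add.
Proof. by move=> [????]; apply: H4_eq; rewrite add0r. Qed.
Lemma H4_addN : left_inverse (H4_elt 0 0 0 0) H4_opp H4_add.
Proof. by move=> [????]; apply: H4_eq; rewrite addNr. Qed.
HB.instance Definition _ :=
  GRing.isZmodule.Build H4 H4_addA H4_addC H4_add0 H4_addN.

Lemma H4_mulA : associative H4_mul.
Proof. by move=> [????] [????] [????]; apply: H4_eq; ring. Qed.
Lemma H4_mul1l : left_id (H4_elt 1 0 0 0) H4_mul.
Proof. by move=> [????]; apply: H4_eq; ring. Qed.
Lemma H4_mul1r : right_id (H4_elt 1 0 0 0) H4_mul.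
Proof. by move=> [????]; apply: H4_eq; ring. Qed.
Lemma H4_mulDl : left_distributive H4_mul +%R.
Proof. by move=> [????] [????] [????]; apply: H4_eq; ring. Qed.
Lemma H4_mulDr : right_distributive H4_mul +%R.
Proof. by move=> [????] [????] [????]; apply: H4_eq; ring. Qed.
Lemma H4_one_neq0 : H4_elt 1 0 0 0 != 0.
Proof. by apply/eqP => /(congr1 H4_c1) /eqP; rewrite oner_eq0. Qed.
HB.instance Definition _ := GRing.Zmodule_isNzRing.Build H4
  H4_mulA H4_mul1l H4_mul1r H4_mulDl H4_mulDr H4_one_neq0.

Lemma H4_scaleA a b v : H4_scale a (H4_scale b v) = H4_scale (a * b) v.
Proof. by case: v => ????; apply: H4_eq; rewrite mulrA. Qed.
Lemma H4_scale1 : left_id 1 H4_scale.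
Proof. by move=> [????]; apply: H4_eq; rewrite mul1r. Qed.
Lemma H4_scaleDr : right_distributive H4_scale +%R.
Proof. by move=> ? [????] [????]; apply: H4_eq; rewrite mulrDr. Qed.
Lemma H4_scaleDl v : {morph H4_scale^~ v : a b / a + b}.
Proof. by case: v => ???? ??; apply: H4_eq; rewrite mulrDl. Qed.
HB.instance Definition _ := GRing.Zmodule_isLmodule.Build k H4
  H4_scaleA H4_scale1 H4_scaleDr H4_scaleDl.

Lemma H4_scaleAl c (u v : H4) : c *: (u * v) = (c *: u) * v.
Proof. by case: u v => [????] [????]; apply: H4_eq; ring. Qed.
HB.instance Definition _ := GRing.Lmodule_isLalgebra.Build k H4 H4_scaleAl.
Lemma H4_scaleAr c (u v : H4) : c *: (u * v) = u * (c *: v).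
Proof. by case: u v => [????] [????]; apply: H4_eq; ring. Qed.
HB.instance Definition _ := GRing.Lalgebra_isAlgebra.Build k H4 H4_scaleAr.

Definition H4_X : H4 := H4_elt 0 1 0 0.
Definition H4_Y : H4 := H4_elt 0 0 1 0.
Local Notation X := H4_X.
Local Notation Y := H4_Y.

Lemma H4_XX : X * X = 1.
Proof. by apply: H4_eq; ring. Qed.
Lemma H4_YY : Y * Y = 0.
Proof. by apply: H4_eq; ring. Qed.
Lemma H4_XY_YX : X * Y + Y * X = 0.
Proof. by apply: H4_eq; ring. Qed.
Lemma H4_YX : Y * X = - (X * Y).
Proof. by apply/eqP; rewrite -addr_eq0 addrC H4_XY_YX. Qed.

Lemma H4_eltE a0 a1 a2 a3 :
  H4_elt a0 a1 a2 a3 = a0%:A + a1 *: X + a2 *: Y + a3 *: (X * Y).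
Proof. by apply: H4_eq; rewrite /=; ring. Qed.

Let one1 : 1 = 1 ⊗ 1 :> tensor H4 H4. Proof. by []. Qed.

Definition H4_comul (h : H4) : tensor H4 H4 :=
  let: H4_elt a0 a1 a2 a3 := h in
  a0 *: (1 ⊗ 1) + a1 *: (X ⊗ X) + a2 *: (1 ⊗ Y + Y ⊗ X)
  + a3 *: (X ⊗ (X * Y) + (X * Y) ⊗ 1).

Definition H4_counit (h : H4) : k := let: H4_elt a0 a1 a2 a3 := h in a0 + a1.

Definition H4_antipode (h : H4) : H4 :=
  let: H4_elt a0 a1 a2 a3 := h in a0%:A + a1 *: X + a2 *: (X * Y) - a3 *: Y.

Lemma H4_comul1 : H4_comul 1 = 1 ⊗ 1.
Proof. by rewrite /H4_comul /= scale1r !scale0r !addr0. Qed.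
Lemma H4_comulX : H4_comul X = X ⊗ X.
Proof. by rewrite /H4_comul /= scale1r !scale0r !addr0 add0r. Qed.
Lemma H4_comulY : H4_comul Y = 1 ⊗ Y + Y ⊗ X.
Proof. by rewrite /H4_comul /= scale1r !scale0r !addr0 !add0r. Qed.

Lemma H4_comul_linear : linear H4_comul.
Proof.
move=> c [a0 a1 a2 a3] [b0 b1 b2 b3].
rewrite [H4_comul (_ + _)]/H4_comul /= /H4_comul.
move: (1 ⊗ 1) (X ⊗ X) (1 ⊗ Y + _) (X ⊗ _ + _) => p q r s.
by rewrite !scalerDr !scalerA !scalerDl !addrA [RHS](ACl (1*5*2*6*3*7*4*8)).
Qed.
Let cD := linD H4_comul_linear.
Let cZ := linZ H4_comul_linear.

Let XXY : X * (X * Y) = Y. Proof. by rewrite mulrA H4_XX mul1r. Qed.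
Let YXY : Y * (X * Y) = 0.
Proof. by rewrite mulrA H4_YX mulNr -mulrA H4_YY mulr0 oppr0. Qed.
Let XYX : X * Y * X = - Y. Proof. by rewrite -mulrA H4_YX mulrN XXY. Qed.
Let XYY : X * Y * Y = 0. Proof. by rewrite -mulrA H4_YY mulr0. Qed.
Let XYXY : X * Y * (X * Y) = 0. Proof. by rewrite -mulrA YXY mulr0. Qed.
Let tNl (a b : H4) : (- a) ⊗ b = - (a ⊗ b).
Proof. by rewrite -scaleN1r tensorZl scaleN1r. Qed.
Let tNr (a b : H4) : a ⊗ (- b) = - (a ⊗ b).
Proof. by rewrite -scaleN1r tensorZr scaleN1r. Qed.

Lemma H4_comulXY : H4_comul (X * Y) = X ⊗ (X * Y) + (X * Y) ⊗ 1.
Proof.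
have -> : X * Y = H4_elt 0 0 0 1 by apply: H4_eq; ring.
rewrite {1}/H4_comul /= scale1r !scale0r !add0r.
by have -> : X * Y = H4_elt 0 0 0 1 by apply: H4_eq; ring.
Qed.

Lemma H4_bilin (V : lmodType k) (F G : H4 -> H4 -> V) :
  (forall v, linear (F^~ v)) -> (forall u, linear (F u)) ->
  (forall v, linear (G^~ v)) -> (forall u, linear (G u)) ->
  (forall u v, u \in [:: 1; X; Y; X * Y] -> v \in [:: 1; X; Y; X * Y] ->
     F u v = G u v) ->
  F =2 G.
Proof.
move=> Fl Fr Gl Gr FG [a0 a1 a2 a3] [b0 b1 b2 b3]; rewrite !H4_eltE.
have FD u1 u2 v : F (u1 + u2) v = F u1 v + F u2 v := linD (Fl v) u1 u2.
have GD u1 u2 v : G (u1 + u2) v = G u1 v + G u2 v := linD (Gl v) u1 u2.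
have FZ c u v : F (c *: u) v = c *: F u v := linZ (Fl v) c u.
have GZ c u v : G (c *: u) v = c *: G u v := linZ (Gl v) c u.
rewrite !(FD, GD) !(FZ, GZ).
rewrite !(linD (Fr _)) !(linD (Gr _)) !(linZ (Fr _)) !(linZ (Gr _)).
by rewrite !FG // !inE ?eqxx ?orbT.
Qed.

Let tE := (H4_XX, H4_YY, H4_YX, XXY, YXY, XYX, XYY, XYXY).
Let cN u : H4_comul (- u) = - H4_comul u.
Proof. by rewrite -scaleN1r cZ scaleN1r. Qed.
Let c0 : H4_comul 0 = 0.
Proof. by rewrite -[X in H4_comul X](scale0r 0) cZ scale0r. Qed.

Lemma H4_comulM : {morph H4_comul : u v / u * v}.
Proof.
apply: H4_bilin => [v|u|v|u|].
- by move=> c x y; rewrite mulrDl -scalerAl H4_comul_linear.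
- by move=> c x y; rewrite mulrDr -scalerAr H4_comul_linear.
- by move=> c x y; rewrite H4_comul_linear mulrDl tensorZAl.
- by move=> c x y; rewrite H4_comul_linear mulrDr tensorZAr.
move=> u v; rewrite !inE => /or4P [] /eqP-> /or4P [] /eqP->;
rewrite ?(mul1r, mulr1, tE) ?(cN, c0);
rewrite ?(H4_comul1, H4_comulX, H4_comulY, H4_comulXY) -?one1 ?mul1r ?mulr1 //;
rewrite ?mulrDl ?mulrDr ?tensorM ?(mul1r, mulr1, tE)
        ?(tNl, tNr, tensor0l, tensor0r, opprK, add0r, addr0) //;
by rewrite ?opprD ?subrr ?addNr.
Qed.

Lemma H4_comul_monoid : monoid_morphism H4_comul.
Proof. by split; [exact: H4_comul1|exact: H4_comulM]. Qed.

Lemma H4_counit_linear : scalar H4_counit.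
Proof. by move=> c [????] [????]; rewrite /=; ring. Qed.
Lemma H4_counit_monoid : monoid_morphism H4_counit.
Proof. by split=> [|[????] [????]]; rewrite /=; ring. Qed.
Lemma H4_antipode_linear : linear H4_antipode.
Proof. by move=> c [????] [????]; apply: H4_eq; rewrite /=; ring. Qed.

Lemma H4_counit1 : H4_counit 1 = 1. Proof. by rewrite /= addr0. Qed.
Lemma H4_counitX : H4_counit X = 1. Proof. by rewrite /= add0r. Qed.
Lemma H4_counitY : H4_counit Y = 0. Proof. by rewrite /= addr0. Qed.
Lemma H4_counitXY : H4_counit (X * Y) = 0.
Proof. by rewrite /=; ring. Qed.
Lemma H4_antipode1 : H4_antipode 1 = 1.
Proof. by apply: H4_eq; rewrite /=; ring. Qed.
Lemma H4_antipodeX : H4_antipode X = X.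
Proof. by apply: H4_eq; rewrite /=; ring. Qed.
Lemma H4_antipodeY : H4_antipode Y = X * Y.
Proof. by apply: H4_eq; rewrite /=; ring. Qed.
Lemma H4_antipodeXY : H4_antipode (X * Y) = - Y.
Proof. by apply: H4_eq; rewrite /=; ring. Qed.

Lemma H4_lin_ext (V : lmodType k) (F G : H4 -> V) :
  linear F -> linear G ->
  F 1 = G 1 -> F X = G X -> F Y = G Y -> F (X * Y) = G (X * Y) -> F =1 G.
Proof.
move=> Fl Gl F1 FX FY FXY [a0 a1 a2 a3]; rewrite !H4_eltE.
have FD u v : F (u + v) = F u + F v := linD Fl u v.
have GD u v : G (u + v) = G u + G v := linD Gl u v.
by rewrite !FD !GD !(linZ Fl) !(linZ Gl) F1 FX FY FXY.
Qed.

Let comp_lin (U V W : lmodType k) (F : U -> V) (G : V -> W) :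
  linear F -> linear G -> linear (fun x => G (F x)).
Proof. by move=> Fl Gl c x y; rewrite Fl Gl. Qed.
Let idL (V : lmodType k) : linear (id : V -> V). Proof. by []. Qed.
Let cL := H4_comul_linear.
Let mL := tensor_map_linear.

Let cE := (H4_comul1, H4_comulX, H4_comulY, H4_comulXY).
Let eE := (H4_counit1, H4_counitX, H4_counitY, H4_counitXY).
Let sE := (H4_antipode1, H4_antipodeX, H4_antipodeY, H4_antipodeXY).

Lemma H4_comulA h :
  tensor_map H4_comul id (H4_comul h) =
  tensor_assoc (tensor_map id H4_comul (H4_comul h)).
Proof.
have L1 : linear (tensor_map H4_comul (id : H4 -> H4)) by exact: mL.
have L2 : linear (tensor_map (id : H4 -> H4) H4_comul) by exact: mL.
pose as_ := @tensor_assoc k H4 H4 H4.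
have L3 : linear as_ by exact: tensor_assoc_linear.
have E1 a b : tensor_map H4_comul id (a ⊗ b) = H4_comul a ⊗ b.
  by rewrite tensor_mapE.
have E2 a b : tensor_map id H4_comul (a ⊗ b) = a ⊗ H4_comul b.
  by rewrite tensor_mapE.
have E3 a b c : as_ (a ⊗ (b ⊗ c)) = (a ⊗ b) ⊗ c by exact: tensor_assocE.
have D3 x y : as_ (x + y) = as_ x + as_ y by exact: linD.
rewrite -/as_; move: h; apply: H4_lin_ext.
- exact: (comp_lin cL L1).
- exact: (comp_lin (comp_lin cL L2) L3).
- by rewrite !cE E1 E2 !cE E3.
- by rewrite !cE E1 E2 !cE E3.
- rewrite !cE (linD L1) (linD L2) !E1 !E2 !cE.
  by rewrite tensorDl tensorDr !D3 !E3 !addrA.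
- rewrite !cE (linD L1) (linD L2) !E1 !E2 !cE.
  by rewrite tensorDl tensorDr !D3 !E3 !addrA.
Qed.

Let conv (f g : H4 -> H4) :
  linear f -> linear g -> forall x y : H4,
  tensor_lift (fun h1 h2 => f h1 * g h2) (x ⊗ y) = f x * g y.
Proof.
move=> fl gl x y; apply: tensor_lift_linearE => u c v w.
  by rewrite fl mulrDl -scalerAl.
by rewrite gl mulrDr -scalerAr.
Qed.
Let conv_lin (f g : H4 -> H4) : linear f -> linear g ->
  linear (tensor_lift (fun h1 h2 => f h1 * g h2)).
Proof.
move=> fl gl; apply: tensor_lift_linear => u c v w.
  by rewrite fl mulrDl -scalerAl.
by rewrite gl mulrDr -scalerAr.
Qed.
Let eL : linear (fun h : H4 => (H4_counit h)%:A : H4).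
Proof.
move=> c u v; rewrite H4_counit_linear scalerDl -scalerA //.
Qed.

Let antip (f g : H4 -> H4) : linear f -> linear g ->
  f 1 * g 1 = 1 -> f X * g X = 1 -> f 1 * g Y + f Y * g X = 0 ->
  f X * g (X * Y) + f (X * Y) * g 1 = 0 ->
  forall h, tensor_lift (fun h1 h2 => f h1 * g h2) (H4_comul h) =
    (H4_counit h)%:A.
Proof.
move=> fl gl e1 e2 e3 e4; have L := conv_lin fl gl.
apply: H4_lin_ext => //; first exact: (comp_lin cL L).
- by rewrite cE conv // e1 eE scale1r.
- by rewrite cE conv // e2 eE scale1r.
- by rewrite !cE (linD L) !conv // e3 eE scale0r.
- by rewrite !cE (linD L) !conv // e4 eE scale0r.
Qed.

Lemma H4_antipode_l h :
  tensor_lift (fun h1 h2 => H4_antipode h1 * h2) (H4_comul h) =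
  (H4_counit h)%:A.
Proof.
move: h; apply: (@antip H4_antipode id) => //; first exact: H4_antipode_linear.
all: by rewrite !sE ?(mul1r, mulr1) ?tE // (addrN, addNr).
Qed.
Lemma H4_antipode_r h :
  tensor_lift (fun h1 h2 => h1 * H4_antipode h2) (H4_comul h) =
  (H4_counit h)%:A.
Proof.
move: h; apply: (@antip id H4_antipode) => //; first exact: H4_antipode_linear.
all: by rewrite !sE ?(mul1r, mulr1) ?mulrN ?tE // (addrN, addNr).
Qed.

Lemma H4_counit_l h :
  tensor_lift (fun h1 h2 => H4_counit h1 *: h2) (H4_comul h) = h.
Proof.
have eq x y : H4_counit x *: y = (H4_counit x)%:A * y :> H4.
  by rewrite -scalerAl mul1r.
have L := conv_lin eL (@idL H4); have E := conv eL (@idL H4).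
transitivity (tensor_lift (fun h1 h2 => (H4_counit h1)%:A * h2) (H4_comul h)).
  exact: eq_tlift.
move: h; apply: H4_lin_ext => //.
- exact: (comp_lin cL L).
- by rewrite cE E eE scale1r mul1r.
- by rewrite cE E eE scale1r mul1r.
- by rewrite !cE (linD L) !E !eE scale1r scale0r mul1r mul0r addr0.
- by rewrite !cE (linD L) !E !eE scale1r scale0r mul1r mul0r addr0.
Qed.
Lemma H4_counit_r h :
  tensor_lift (fun h1 h2 => H4_counit h2 *: h1) (H4_comul h) = h.
Proof.
have eq x y : H4_counit y *: x = x * (H4_counit y)%:A :> H4.
  by rewrite -scalerAr mulr1.
have L := conv_lin (@idL H4) eL; have E := conv (@idL H4) eL.
transitivity (tensor_lift (fun h1 h2 => h1 * (H4_counit h2)%:A) (H4_comul h)).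
  exact: eq_tlift.
move: h; apply: H4_lin_ext => //.
- exact: (comp_lin cL L).
- by rewrite cE E eE scale1r mul1r.
- by rewrite cE E eE scale1r mulr1.
- by rewrite !cE (linD L) !E !eE scale1r scale0r mulr1 mulr0 add0r.
- by rewrite !cE (linD L) !E !eE scale1r scale0r mulr1 mulr0 add0r.
Qed.

Definition H4_hopf : hopfAlg k :=
  HopfAlg H4_comul_linear H4_comul_monoid H4_counit_linear H4_counit_monoid
    H4_antipode_linear H4_comulA H4_counit_l H4_counit_r
    H4_antipode_l H4_antipode_r.

End Sweedler.

(* Main.v *)
From HB Require Import structures.
Require Import Defs.
From mathcomp Require Import all_boot all_algebra.
From mathcomp Require Import boolp.
From mathcomp Require Import mpoly.
From mathcomp Require Import ring.

Set Implicit Arguments.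
Unset Strict Implicit.
Unset Printing Implicit Defensive.

Import GRing.Theory.
Local Open Scope ring_scope.

(* A cleaving map, normalised by gamma(1)^-1, provides x and y in A with the  *)
(* coactions of X and Y.  Then x^2, y^2 and xy + yx are coinvariant, and as 2 *)
(* is invertible y can be corrected by a multiple of x so that xy + yx = 0.   *)
(* The coaction forces 1, x, y, xy to be a C-basis of A, so A is the algebra  *)
(* with x^2 = a (a unit), y^2 = b, yx = - xy.  Over the finite etale          *)
(* extension C[s] / (s^2 - a), replacing x by x / s gives x^2 = 1, and then   *)
(* y^2 = t b is a path from the trivial bundle (t = 0) to A (t = 1).          *)

(** Everything reduces to one family of bundles: [quat b], free on 1, x, y, xy with x^2 = 1, y^2 =
    b, yx = - xy. Each [quat b] is a bundle ([quat_bundle]), base change only moves the parameter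
    ([pushforward_quat_bundle]), and [quat 0] is trivial ([quat0_trivial]). Hence [quat (t b)] over
    the polynomial ring joins the trivial bundle to [quat b].

    It remains to bring a cleft A into this family after a finite etale extension.
    [cleft_generators] extracts x and y from the cleaving map, with x^2 = a a unit, y^2 = b and yx =
    - xy. [sweedler_gen_bij] shows that the coactions of x and y alone make 1, x, y, xy a basis of A
    over C, so no other relations are hidden. Once a has a square root s, x / s squares to 1 and the
    push-forward of A is [quat b] ([pushforward_quat]). Adjoining s is finite etale because 2 and a
    are units ([sqrt_finite_etale]). *)

Section SqrtExt.
Variables (k : comNzRingType) (C : comAlgType k) (a : C).

(* (u, v) stands for u + v s in C[s] / (s^2 - a). *)
Definition sqrt_ext : Type := let _ := a in (C * C)%type.
HB.instance Definition _ := GRing.Lmodule.copy sqrt_ext (C * C)%type.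

Definition sqrt_mul (p q : sqrt_ext) : sqrt_ext :=
  (p.1 * q.1 + a * p.2 * q.2, p.1 * q.2 + p.2 * q.1).

Let pairE (p q : sqrt_ext) : p.1 = q.1 -> p.2 = q.2 -> p = q.
Proof. by case: p q => ? ? [? ?] /= -> ->. Qed.

Let mulA : associative sqrt_mul.
Proof. by move=> p q r; apply: pairE => /=; ring. Qed.
Let mulC : commutative sqrt_mul.
Proof. by move=> p q; apply: pairE => /=; ring. Qed.
Let mul1 : left_id ((1, 0) : sqrt_ext) sqrt_mul.
Proof. by move=> p; apply: pairE => /=; ring. Qed.
Let mulDl : left_distributive sqrt_mul +%R.
Proof. by move=> p q r; apply: pairE => /=; ring. Qed.
Let one_neq0 : ((1, 0) : sqrt_ext) != 0.
Proof. by apply/eqP => /(congr1 fst) /eqP; rewrite oner_eq0. Qed.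
HB.instance Definition _ :=
  GRing.Zmodule_isComNzRing.Build sqrt_ext mulA mulC mul1 mulDl one_neq0.

Let scaleAl (c : k) (p q : sqrt_ext) : c *: (p * q) = (c *: p : sqrt_ext) * q.
Proof.
by apply: pairE; rewrite /= scalerDr -?scalerAr -!scalerAl.
Qed.
HB.instance Definition _ := GRing.Lmodule_isLalgebra.Build k sqrt_ext scaleAl.
HB.instance Definition _ := GRing.Lalgebra_isComAlgebra.Build k sqrt_ext.

Definition sqrt_root : sqrt_ext := (0, 1).
Definition sqrt_in (c : C) : sqrt_ext := (c, 0).

Let in_linear : linear sqrt_in.
Proof. by move=> c u v; apply: pairE => //=; rewrite scaler0 addr0. Qed.
HB.instance Definition _ :=
  GRing.isLinear.Build k C sqrt_ext *:%R sqrt_in in_linear.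
Let in_monoid : monoid_morphism sqrt_in.
Proof. by split=> [|u v] //; apply: pairE => /=; ring. Qed.
HB.instance Definition _ :=
  GRing.isMonoidMorphism.Build C sqrt_ext sqrt_in in_monoid.

Lemma sqrt_rootM : sqrt_root * sqrt_root = sqrt_in a.
Proof. by apply: pairE => /=; ring. Qed.

Lemma sqrt_extE (p : sqrt_ext) : p = sqrt_in p.1 + sqrt_in p.2 * sqrt_root.
Proof. by apply: pairE => /=; ring. Qed.

Lemma sqrt_finite : finite_morph sqrt_in.
Proof.
exists 2%N, (fun i => if i == ord0 then 1 else sqrt_root) => p.
exists (fun i => if i == ord0 then p.1 else p.2).
by rewrite !big_ord_recl big_ord0 /= mulr1 addr0 -sqrt_extE.
Qed.

Let rel : {mpoly C[1]} := 'X_ord0 ^+ 2 - a%:MP.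

(** Division with remainder by the monic [rel]: the polynomials of this form contain the constants
    and are closed under sums and under multiplication by the variable. *)
Let reduce (p : {mpoly C[1]}) : exists q u v,
  p = q * rel + u%:MP + v%:MP * 'X_ord0.
Proof.
pose nf (p : {mpoly C[1]}) := exists q u v,
  p = q * rel + u%:MP + v%:MP * 'X_ord0.
have nfD p1 p2 : nf p1 -> nf p2 -> nf (p1 + p2).
  move=> [q1 [u1 [v1 ->]]] [q2 [u2 [v2 ->]]].
  by exists (q1 + q2), (u1 + u2), (v1 + v2); rewrite !mpolyCD; ring.
(* v X^2 = v rel + v a, so the quotient gains v and v a becomes the constant term. *)
have nfX p1 : nf p1 -> nf (p1 * 'X_ord0).
  move=> [q [u [v ->]]]; exists (q * 'X_ord0 + v%:MP), (v * a), u.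
  by rewrite mpolyCM /rel; ring.
have nfC c : nf c%:MP by exists 0, c, 0; rewrite mpolyC0; ring.
elim/mpolyind: p => [|c m p _ _ nfp]; first by rewrite -mpolyC0; apply: nfC.
apply: nfD nfp.
rewrite -mul_mpolyC mpolyXE_id big_ord_recl big_ord0 mulr1.
elim: (m ord0) => [|n IHn]; first by rewrite expr0 mulr1; apply: nfC.
by rewrite exprSr mulrA; apply: nfX.
Qed.

Lemma sqrt_finitely_presented : finitely_presented sqrt_in.
Proof.
pose v (i : 'I_1) := sqrt_root.
have evC c : mmap sqrt_in v c%:MP = sqrt_in c by rewrite mmapC.
have evX : mmap sqrt_in v 'X_ord0 = sqrt_root by rewrite mmapX mmap1U.
have evr : mmap sqrt_in v rel = 0.
  by rewrite rmorphB rmorphXn /= evX evC expr2 sqrt_rootM subrr.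
exists 1%N, v; split=> [d|].
  exists (d.1%:MP + d.2%:MP * 'X_ord0).
  by rewrite rmorphD rmorphM /= !evC evX -sqrt_extE.
exists 1%N, (fun _ => rel) => p; split=> [|[q ->]]; last first.
  by rewrite big_ord_recl big_ord0 addr0 rmorphM /= evr mulr0.
(* Evaluation at s kills the multiple of [rel] and leaves u + w s, which vanishes only if u and w
   do. *)
have [q [u [w ->]]] := reduce p.
rewrite !rmorphD !rmorphM /= evr !evC evX mulr0 add0r => e.
have /= u0 := congr1 fst (etrans (sqrt_extE (u, w)) e).
have /= w0 := congr1 snd (etrans (sqrt_extE (u, w)) e).
exists (fun=> q); rewrite big_ord_recl big_ord0 u0 w0 mpolyC0; ring.
Qed.

(* One Newton step turns any lift of s into a square root of a.               *)
Lemma sqrt_formally_etale (a' u : C) :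
  a * a' = 1 -> 2%:R * u = 1 -> formally_etale sqrt_in.
Proof.
move=> aa' uu S T p psurj psq g h ph.
have gaa : g a * g a' = 1 by rewrite -rmorphM aa' rmorph1.
have guu : 2%:R * g u = 1 by rewrite -(rmorph_nat g 2) -rmorphM uu rmorph1.
have [s0 ps0] := psurj (h sqrt_root).
have phc c : p (g c) = h (sqrt_in c) by exact: ph.
pose e := s0 * s0 - g a.
have pe : p e = 0.
  by rewrite rmorphB rmorphM /= phc ps0 -rmorphM sqrt_rootM subrr.
have ee : e * e = 0 by apply: psq.
(* The Newton step s0 - e / (2 s0), with 1 / s0 replaced by s0 / a, which agrees with it modulo e;
   as e^2 = 0 the result squares to a exactly. *)
pose s := s0 * (1 - e * g u * g a').
have ps : p s = h sqrt_root.
  by rewrite !rmorphM rmorphB !rmorphM /= pe !mul0r subr0 rmorph1 mulr1.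
have ss : s * s = g a.
  have s0E : s0 * s0 = g a + e by rewrite /e addrC subrK.
  have -> : s * s = s0 * s0 * (1 - 2%:R * g u * (e * g a')
              + e * e * (g u * g u * g a' * g a')) by rewrite /s; ring.
  rewrite ee mul0r addr0 s0E guu.
  have -> : (g a + e) * (1 - 1 * (e * g a'))
    = g a + e * (1 - g a * g a') - e * e * g a' by ring.
  by rewrite gaa subrr mulr0 addr0 ee mul0r subr0.
pose w0 (d : sqrt_ext) : S := g d.1 + g d.2 * s.
have w0B : zmod_morphism w0.
  by move=> x y; rewrite /w0 /= !rmorphB; ring.
have w0M : monoid_morphism w0.
  split=> [|x y]; first by rewrite /w0 /= rmorph1 rmorph0 mul0r addr0.
  rewrite /w0 /= !rmorphD !rmorphM /= -ss; ring.
pose w0A := GRing.isZmodMorphism.Build sqrt_ext S w0 w0B.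
pose w0R := GRing.isMonoidMorphism.Build sqrt_ext S w0 w0M.
pose w : {rmorphism sqrt_ext -> S} := HB.pack w0 w0A w0R.
exists w; split=> [c|d|w' w'g w'p].
- by rewrite /= /w0 /= rmorph0 mul0r addr0.
- by rewrite /= /w0 rmorphD rmorphM /= ps !phc -rmorphM -rmorphD -sqrt_extE.
move=> d; rewrite [in LHS](sqrt_extE d) rmorphD rmorphM /= /w0.
have w'c c : w' (sqrt_in c) = g c by exact: w'g.
rewrite !w'c; congr (_ + _ * _).
pose x := w' sqrt_root; rewrite -/x.
have xx : x * x = g a by rewrite -rmorphM sqrt_rootM w'c.
have px : p x = h sqrt_root by exact: w'p.
(* Uniqueness: two lifts of the root differ by some d with d^2 = 0; comparing their squares gives 2
   s d = 0, and both 2 and s are units. *)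
have d2 : (x - s) * (x - s) = 0 by apply: psq; rewrite rmorphB px ps /= subrr.
have sx : s * (x - s) = 0.
  rewrite -[LHS]mul1r -guu.
  have -> : 2%:R * g u * (s * (x - s)) =
    g u * (x * x - s * s - (x - s) * (x - s)) by ring.
  by rewrite xx ss d2 subrr subr0 mulr0.
apply/eqP; rewrite -subr_eq0; apply/eqP.
rewrite -[LHS]mul1r -gaa -ss.
have -> : s * s * g a' * (x - s) = s * g a' * (s * (x - s)) by ring.
by rewrite sx mulr0.
Qed.

Lemma sqrt_finite_etale (a' u : C) :
  a * a' = 1 -> 2%:R * u = 1 -> finite_etale sqrt_in.
Proof.
move=> aa' uu; split; first exact: sqrt_finite.
by split; [exact: sqrt_formally_etale aa' uu|exact: sqrt_finitely_presented].
Qed.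
End SqrtExt.

(** * Coordinates in H_4 and in tensors with H_4 *)

Lemma sum4D (V : zmodType) (a b c d a' b' c' d' : V) :
  (a + a') + (b + b') + (c + c') + (d + d')
  = (a + b + c + d) + (a' + b' + c' + d').
Proof. by rewrite !addrA [LHS](ACl (1*3*5*7*2*4*6*8)). Qed.

Section Sweedler.
Variable k : fieldType.
Local Notation H := (H4_hopf k).

Definition swX : H := H4_X k.
Definition swY : H := H4_Y k.

Lemma swXX : swX * swX = 1. Proof. exact: H4_XX. Qed.
Lemma swYY : swY * swY = 0. Proof. exact: H4_YY. Qed.
Lemma swYX : swY * swX = - (swX * swY). Proof. exact: H4_YX. Qed.

Lemma comul_swX : comul swX = swX ⊗ swX. Proof. exact: H4_comulX. Qed.
Lemma comul_swY : comul swY = 1 ⊗ swY + swY ⊗ swX. Proof. exact: H4_comulY. Qed.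
Lemma comul_swXY : comul (swX * swY) = swX ⊗ (swX * swY) + (swX * swY) ⊗ 1.
Proof. exact: H4_comulXY. Qed.
Lemma comul1 : comul (1 : H) = 1 ⊗ 1. Proof. exact: H4_comul1. Qed.

(** The counit and the coordinate functions get names over [H] so that each can carry a linear
    structure and stay folded under simplification. *)
Definition sw_counit (h : H) : k := counit h.
Definition sw1_coord (h : H) : k := H4_c1 h.
Definition swX_coord (h : H) : k := H4_cX h.
Definition swY_coord (h : H) : k := H4_cY h.
Definition swXY_coord (h : H) : k := H4_cXY h.

Arguments sw_counit h : simpl never.
Arguments sw1_coord h : simpl never.
Arguments swX_coord h : simpl never.
Arguments swY_coord h : simpl never.
Arguments swXY_coord h : simpl never.

Let counit_linear : scalar sw_counit. Proof. exact: counit_linear. Qed.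
Let c1_linear : scalar sw1_coord. Proof. by move=> c [????] [????]. Qed.
Let cX_linear : scalar swX_coord. Proof. by move=> c [????] [????]. Qed.
Let cY_linear : scalar swY_coord. Proof. by move=> c [????] [????]. Qed.
Let cXY_linear : scalar swXY_coord. Proof. by move=> c [????] [????]. Qed.
HB.instance Definition _ := GRing.isLinear.Build k H k *%R sw_counit counit_linear.
HB.instance Definition _ := GRing.isLinear.Build k H k *%R sw1_coord c1_linear.
HB.instance Definition _ := GRing.isLinear.Build k H k *%R swX_coord cX_linear.
HB.instance Definition _ := GRing.isLinear.Build k H k *%R swY_coord cY_linear.
HB.instance Definition _ := GRing.isLinear.Build k H k *%R swXY_coord cXY_linear.

Lemma swXY_elt : swX * swY = H4_elt 0 0 0 1 :> H4 k.
Proof. by apply: H4_eq; rewrite /=; ring. Qed.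

Lemma sw_counitE : (sw_counit 1 = 1) * (sw_counit swX = 1) *
  (sw_counit swY = 0) * (sw_counit (swX * swY) = 0).
Proof.
do !split; [exact: H4_counit1|exact: H4_counitX|exact: H4_counitY|exact: H4_counitXY].
Qed.
Lemma sw1_coordE : (sw1_coord 1 = 1) * (sw1_coord swX = 0) *
  (sw1_coord swY = 0) * (sw1_coord (swX * swY) = 0).
Proof. by rewrite /sw1_coord swXY_elt. Qed.
Lemma swX_coordE : (swX_coord 1 = 0) * (swX_coord swX = 1) *
  (swX_coord swY = 0) * (swX_coord (swX * swY) = 0).
Proof. by rewrite /swX_coord swXY_elt. Qed.
Lemma swY_coordE : (swY_coord 1 = 0) * (swY_coord swX = 0) *
  (swY_coord swY = 1) * (swY_coord (swX * swY) = 0).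
Proof. by rewrite /swY_coord swXY_elt. Qed.
Lemma swXY_coordE : (swXY_coord 1 = 0) * (swXY_coord swX = 0) *
  (swXY_coord swY = 0) * (swXY_coord (swX * swY) = 1).
Proof. by rewrite /swXY_coord swXY_elt. Qed.

Lemma sw_coordP (h : H) : h = (sw1_coord h)%:A + swX_coord h *: swX
  + swY_coord h *: swY + swXY_coord h *: (swX * swY).
Proof. by case: h => ????; apply: H4_eltE. Qed.

Section Slice.
Variables (M : lmodType k) (f : {scalar H}).

(** The map id ⊗ f into M ⊗ k = M. Given a coordinate function of H_4, it reads off a component of a
    tensor along the basis 1, X, Y, XY. *)
Definition slice : tensor M H -> M := tensor_lift (fun m h => f h *: m).

Let lin_l h : linear (fun m : M => f h *: m).
Proof. by move=> c m n; rewrite scalerDr !scalerA mulrC. Qed.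
Let lin_r (m : M) : linear (fun h => f h *: m).
Proof. by move=> c g h; rewrite linearP scalerDl scalerA. Qed.
Let slice_linear : linear slice.
Proof. exact: tensor_lift_linear. Qed.
HB.instance Definition _ :=
  GRing.isLinear.Build k (tensor M H) M *:%R slice slice_linear.

Lemma sliceE m h : slice (m ⊗ h) = f h *: m.
Proof. exact: tensor_lift_linearE. Qed.
End Slice.

Lemma slice_map (M N : lmodType k) (g : M -> N) (f : {scalar H}) t :
  linear g -> slice f (tensor_map g id t) = g (slice f t).
Proof.
move=> gL; have gD := linD gL.
move: t; apply: tensor_ext => [u v|u v|m h]; first by rewrite tensor_mapD ?linearD.
  by rewrite linearD gD.
by rewrite tensor_mapE // !sliceE (linZ gL).
Qed.

Lemma tensor_sliceE (M : lmodType k) (t : tensor M H) :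
  t = slice sw1_coord t ⊗ 1 + slice swX_coord t ⊗ swX
    + slice swY_coord t ⊗ swY + slice swXY_coord t ⊗ (swX * swY).
Proof.
move: t; apply: tensor_ext => [//|u v|m h].
  by rewrite !linearD !tensorDl /= sum4D.
rewrite !sliceE !tensorZl -!tensorZr -!tensorDr; congr (_ ⊗ _); exact: sw_coordP.
Qed.
End Sweedler.

Arguments swX {k}.
Arguments swY {k}.
Arguments sw_counit {k} h : simpl never.
Arguments sw1_coord {k} h : simpl never.
Arguments swX_coord {k} h : simpl never.
Arguments swY_coord {k} h : simpl never.
Arguments swXY_coord {k} h : simpl never.

Lemma pureNl (k : comNzRingType) (M N : lmodType k) (m : M) (n : N) :
  (- m) ⊗ n = - (m ⊗ n).
Proof. by rewrite -scaleN1r tensorZl scaleN1r. Qed.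
Lemma pureNr (k : comNzRingType) (M N : lmodType k) (m : M) (n : N) :
  m ⊗ (- n) = - (m ⊗ n).
Proof. by rewrite -scaleN1r tensorZr scaleN1r. Qed.

(** * The algebras with x^2 = 1, y^2 = b, yx = - xy *)

Section Quat.
Variables (k : fieldType) (K : comAlgType k).

(* mkq b c0 c1 c2 c3 stands for c0 + c1 x + c2 y + c3 xy in the K-algebra     *)
(* with x^2 = 1, y^2 = b and yx = - xy; for b = 0 this is K ⊗ H4.             *)
Record quat (b : K) : Type := mkq { q0 : K; q1 : K; q2 : K; q3 : K }.

Arguments q0 {b} _.
Arguments q1 {b} _.
Arguments q2 {b} _.
Arguments q3 {b} _.

Variable b : K.
Local Notation Q := (quat b).
Local Notation mk := (mkq b).

Let code (v : Q) : K * K * K * K := (q0 v, q1 v, q2 v, q3 v).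
Let decode (t : K * K * K * K) : Q :=
  let: (c0, c1, c2, c3) := t in mk c0 c1 c2 c3.
Let codeK : cancel code decode. Proof. by case. Qed.
HB.instance Definition _ := Choice.copy Q (can_type codeK).

Lemma mkqE (v : Q) : v = mk (q0 v) (q1 v) (q2 v) (q3 v).
Proof. by case: v. Qed.

Definition quat_add (u v : Q) : Q :=
  mk (q0 u + q0 v) (q1 u + q1 v) (q2 u + q2 v) (q3 u + q3 v).
Definition quat_opp (u : Q) : Q := mk (- q0 u) (- q1 u) (- q2 u) (- q3 u).
Definition quat_scale (c : k) (u : Q) : Q :=
  mk (c *: q0 u) (c *: q1 u) (c *: q2 u) (c *: q3 u).

Lemma quat_eq (u v : Q) :
  q0 u = q0 v -> q1 u = q1 v -> q2 u = q2 v -> q3 u = q3 v -> u = v.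
Proof. by case: u v => [????] [????] /= -> -> -> ->. Qed.

Let addA : associative quat_add.
Proof. by move=> u v w; apply: quat_eq; rewrite /= addrA. Qed.
Let addC : commutative quat_add.
Proof. by move=> u v; apply: quat_eq; rewrite /= addrC. Qed.
Let add0 : left_id (mk 0 0 0 0) quat_add.
Proof. by move=> u; apply: quat_eq; rewrite /= add0r. Qed.
Let addN : left_inverse (mk 0 0 0 0) quat_opp quat_add.
Proof. by move=> u; apply: quat_eq; rewrite /= addNr. Qed.
HB.instance Definition _ := GRing.isZmodule.Build Q addA addC add0 addN.

Let scaleA c d v : quat_scale c (quat_scale d v) = quat_scale (c * d) v.
Proof. by apply: quat_eq; rewrite /= scalerA. Qed.
Let scale1 : left_id 1 quat_scale.
Proof. by move=> v; apply: quat_eq; rewrite /= scale1r. Qed.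
Let scaleDr : right_distributive quat_scale +%R.
Proof. by move=> c u v; apply: quat_eq; rewrite /= scalerDr. Qed.
Let scaleDl v : {morph quat_scale^~ v : c d / c + d}.
Proof. by move=> c d; apply: quat_eq; rewrite /= scalerDl. Qed.
HB.instance Definition _ :=
  GRing.Zmodule_isLmodule.Build k Q scaleA scale1 scaleDr scaleDl.

Lemma mkqD c0 c1 c2 c3 d0 d1 d2 d3 : mk c0 c1 c2 c3 + mk d0 d1 d2 d3 =
  mk (c0 + d0) (c1 + d1) (c2 + d2) (c3 + d3).
Proof. by []. Qed.

Lemma mkqZ (c : k) c0 c1 c2 c3 : c *: mk c0 c1 c2 c3 =
  mk (c *: c0) (c *: c1) (c *: c2) (c *: c3).
Proof. by []. Qed.

Definition quat_mul (u v : Q) : Q := mk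
  (q0 u * q0 v + q1 u * q1 v + b * (q2 u * q2 v) - b * (q3 u * q3 v))
  (q0 u * q1 v + q1 u * q0 v + b * (q3 u * q2 v) - b * (q2 u * q3 v))
  (q0 u * q2 v + q2 u * q0 v + q1 u * q3 v - q3 u * q1 v)
  (q0 u * q3 v + q3 u * q0 v + q1 u * q2 v - q2 u * q1 v).

Let qmulA : associative quat_mul.
Proof. by move=> u v w; apply: quat_eq; rewrite /=; ring. Qed.
Let qmul1l : left_id (mk 1 0 0 0) quat_mul.
Proof. by move=> u; apply: quat_eq; rewrite /=; ring. Qed.
Let qmul1r : right_id (mk 1 0 0 0) quat_mul.
Proof. by move=> u; apply: quat_eq; rewrite /=; ring. Qed.
Let qmulDl : left_distributive quat_mul +%R.
Proof. by move=> u v w; apply: quat_eq; rewrite /=; ring. Qed.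
Let qmulDr : right_distributive quat_mul +%R.
Proof. by move=> u v w; apply: quat_eq; rewrite /=; ring. Qed.
Let one_neq0 : mk 1 0 0 0 != 0.
Proof. by apply/eqP => /(congr1 q0) /eqP; rewrite oner_eq0. Qed.
HB.instance Definition _ :=
  GRing.Zmodule_isNzRing.Build Q qmulA qmul1l qmul1r qmulDl qmulDr one_neq0.

Lemma mkqM c0 c1 c2 c3 d0 d1 d2 d3 : mk c0 c1 c2 c3 * mk d0 d1 d2 d3 = mk
  (c0 * d0 + c1 * d1 + b * (c2 * d2) - b * (c3 * d3))
  (c0 * d1 + c1 * d0 + b * (c3 * d2) - b * (c2 * d3))
  (c0 * d2 + c2 * d0 + c1 * d3 - c3 * d1)
  (c0 * d3 + c3 * d0 + c1 * d2 - c2 * d1).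
Proof. by []. Qed.

Let scaleAl (c : k) (u v : Q) : c *: (u * v) = (c *: u : Q) * v.
Proof.
rewrite (mkqE u) (mkqE v) mkqZ !mkqM mkqZ.
by congr mk; rewrite !scalerDr !scalerN -?scalerAr -!scalerAl -?scalerAr.
Qed.
HB.instance Definition _ := GRing.Lmodule_isLalgebra.Build k Q scaleAl.
Let scaleAr (c : k) (u v : Q) : c *: (u * v) = u * (c *: v : Q).
Proof.
rewrite (mkqE u) (mkqE v) mkqZ !mkqM mkqZ.
by congr mk; rewrite !scalerDr !scalerN -!scalerAr.
Qed.
HB.instance Definition _ := GRing.Lalgebra_isAlgebra.Build k Q scaleAr.

Definition quat_base (c : K) : Q := mk c 0 0 0.
Definition quat_x : Q := mk 0 1 0 0.
Definition quat_y : Q := mk 0 0 1 0.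

Let base_linear : linear quat_base.
Proof. by move=> c u v; rewrite /quat_base mkqZ mkqD !scaler0 !addr0. Qed.
HB.instance Definition _ :=
  GRing.isLinear.Build k K Q *:%R quat_base base_linear.
Let base_monoid : monoid_morphism quat_base.
Proof. by split=> // u v; rewrite /quat_base mkqM; congr mk; ring. Qed.
HB.instance Definition _ :=
  GRing.isMonoidMorphism.Build K Q quat_base base_monoid.

Lemma quat_baseMl c v :
  quat_base c * v = mk (c * q0 v) (c * q1 v) (c * q2 v) (c * q3 v).
Proof. by rewrite [v in LHS]mkqE mkqM; congr mk; ring. Qed.
Lemma quat_base_central c v : quat_base c * v = v * quat_base c.
Proof. by rewrite (mkqE v) !mkqM; congr mk; ring. Qed.
Lemma quat_xx : quat_x * quat_x = 1.
Proof. by rewrite mkqM; congr mk; ring. Qed.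
Lemma quat_yy : quat_y * quat_y = quat_base b.
Proof. by rewrite mkqM; congr mk; ring. Qed.
Lemma quat_xy : quat_x * quat_y = mk 0 0 0 1.
Proof. by rewrite mkqM; congr mk; ring. Qed.
Lemma quat_yx : quat_y * quat_x = - (quat_x * quat_y).
Proof.
apply/eqP; rewrite -addr_eq0 !mkqM mkqD; apply/eqP; congr mk; ring.
Qed.

Section Universal.
Variables (R : algType k) (J : {lrmorphism K -> R}) (x y : R).

(** Stated for arbitrary x and y: as a linear map it also serves as a coordinate system on algebras
    where x^2 is not 1. The relations enter only for multiplicativity. *)
Definition quat_gen (v : Q) : R :=
  J (q0 v) + J (q1 v) * x + J (q2 v) * y + J (q3 v) * (x * y).

Hypothesis JC : forall c r, J c * r = r * J c.
Hypotheses (xx : x * x = 1) (yy : y * y = J b) (yx : y * x = - (x * y)).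

Lemma quat_gen_linear : linear quat_gen.
Proof.
move=> c u v; rewrite /quat_gen !linearP /= !mulrDl !scalerDr -!scalerAl !addrA.
by rewrite [LHS](ACl (1*3*5*7*2*4*6*8)).
Qed.

Lemma quat_gen_monoid : monoid_morphism quat_gen.
Proof.
split=> [|u v]; first by rewrite /quat_gen /= rmorph1 rmorph0 !mul0r !addr0.
have JM c d g h : J c * g * (J d * h) = J (c * d) * (g * h).
  by rewrite rmorphM -!mulrA; congr (_ * _); rewrite !mulrA -JC.
have JM1 c d h : J c * (J d * h) = J (c * d) * h by rewrite rmorphM mulrA.
have JM2 c d g : J c * g * J d = J (c * d) * g.
  by rewrite -mulrA -JC JM1.
have xxy : x * (x * y) = y by rewrite mulrA xx mul1r.
have xyx : x * y * x = - y by rewrite -mulrA yx mulrN xxy.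
have yxy : y * (x * y) = - (J b * x) by rewrite mulrA yx mulNr -mulrA yy -JC.
have xyy : x * y * y = J b * x by rewrite -mulrA yy -JC.
have xyxy : x * y * (x * y) = - J b by rewrite mulrA xyx mulNr yy.
rewrite [in RHS]/quat_gen !mulrDl !mulrDr !addrA.
rewrite !JM !JM1 !JM2 -!(rmorphM J).
rewrite xx xxy xyx yxy xyy xyxy yx yy !mulrN !mulr1 !JM1 -!(rmorphM J).
(* The sixteen products are grouped by coordinate, in the order of [quat_mul]. *)
rewrite [RHS](ACl (1*6*11*16*2*5*15*12*3*9*8*14*4*13*7*10)).
rewrite /quat_gen !(rmorphD, rmorphN) !mulrDl !mulNr !addrA.
by rewrite -!(mulrC b).
Qed.

Definition quat_mor : {lrmorphism Q -> R} :=
  HB.pack quat_gen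
    (GRing.isLinear.Build k Q R *:%R quat_gen quat_gen_linear)
    (GRing.isMonoidMorphism.Build Q R quat_gen quat_gen_monoid).
End Universal.
End Quat.

Arguments q0 {k K b} _.
Arguments q1 {k K b} _.
Arguments q2 {k K b} _.
Arguments q3 {k K b} _.

(** * Products of the coactions x ⊗ X and 1 ⊗ Y + y ⊗ X *)

Section Hat.
Variables (k : fieldType) (A : algType k).
Local Notation H := (H4_hopf k).

Definition tens1 (a : A) : tensor A H := a ⊗ 1.

Let tens1_linear : linear tens1.
Proof. exact: pure_linl. Qed.
HB.instance Definition _ :=
  GRing.isLinear.Build k A (tensor A H) *:%R tens1 tens1_linear.
Let tens1_monoid : monoid_morphism tens1.
Proof. by split=> // a b; rewrite [RHS]tensorM mulr1. Qed.
HB.instance Definition _ :=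
  GRing.isMonoidMorphism.Build A (tensor A H) tens1 tens1_monoid.

Lemma tens1M (a b : A) (h : H) : tens1 a * (b ⊗ h) = (a * b) ⊗ h.
Proof. by rewrite [LHS]tensorM mul1r. Qed.

(* The coactions of the images of X and Y under a cleaving map. *)
Definition hatX (x : A) : tensor A H := x ⊗ swX.
Definition hatY (y : A) : tensor A H := 1 ⊗ swY + y ⊗ swX.

Lemma hatXX x : hatX x * hatX x = tens1 (x * x).
Proof. by rewrite [LHS]tensorM swXX. Qed.
(** The XY terms here and in [hatYX] are opposite, so the anticommutator of [hatX x] and [hatY y] is
    (xy + yx) ⊗ 1. *)
Lemma hatXY x y : hatX x * hatY y = x ⊗ (swX * swY) + (x * y) ⊗ 1.
Proof. by rewrite mulrDr ![hatX x * _]tensorM swXX mulr1. Qed.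
Lemma hatYX x y : hatY y * hatX x = (y * x) ⊗ 1 - x ⊗ (swX * swY).
Proof.
by rewrite mulrDl ![_ * hatX x]tensorM swXX swYX mul1r pureNr addrC.
Qed.
(** Y^2 = 0 kills one term, and YX = - XY cancels the two mixed ones. *)
Lemma hatYY y : hatY y * hatY y = tens1 (y * y).
Proof.
rewrite mulrDl !mulrDr.
have -> : (1 : A) ⊗ (swY : H) * (1 ⊗ swY) = 0 by rewrite tensorM swYY tensor0r.
have -> : (1 : A) ⊗ (swY : H) * (y ⊗ swX) = - (y ⊗ (swX * swY)).
  by rewrite tensorM mul1r swYX pureNr.
have -> : y ⊗ (swX : H) * (1 ⊗ swY) = y ⊗ (swX * swY) by rewrite tensorM mulr1.
by rewrite add0r addrA addNr add0r [LHS]tensorM swXX.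
Qed.
End Hat.

(** * The H_4-comodule algebra structure on [quat b] *)

Section QuatComod.
Variables (k : fieldType) (K : comAlgType k) (b : K).
Local Notation H := (H4_hopf k).
Local Notation Q := (quat b).

Let J : {lrmorphism K -> tensor Q H} := @tens1 k Q \o @quat_base k K b.

Let JC c (r : tensor Q H) : J c * r = r * J c.
Proof.
rewrite /=; elim/tensor_ind: r => [|v h|r s IHr IHs]; first by rewrite mulr0 mul0r.
  by rewrite tens1M [RHS]tensorM mulr1 quat_base_central.
by rewrite mulrDr mulrDl IHr IHs.
Qed.

Let xx : hatX (quat_x b) * hatX (quat_x b) = 1.
Proof. by rewrite hatXX quat_xx. Qed.
Let yy : hatY (quat_y b) * hatY (quat_y b) = J b.
Proof. by rewrite hatYY quat_yy. Qed.
Let yx : hatY (quat_y b) * hatX (quat_x b) = - (hatX (quat_x b) * hatY (quat_y b)).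
Proof. by rewrite hatXY hatYX quat_yx pureNl -opprD addrC. Qed.

(** Obtained from the universal property: x ⊗ X and 1 ⊗ Y + y ⊗ X satisfy in Q ⊗ H the relations of
    x and y, so the coaction is an algebra morphism by construction. *)
Definition quat_coact : {lrmorphism Q -> tensor Q H} := quat_mor JC xx yy yx.

Lemma quat_coactE v : quat_coact v =
  mkq b (q0 v) 0 0 0 ⊗ 1 + mkq b 0 (q1 v) 0 0 ⊗ swX
  + (mkq b (q2 v) 0 0 0 ⊗ swY + mkq b 0 0 (q2 v) 0 ⊗ swX)
  + (mkq b 0 (q3 v) 0 0 ⊗ (swX * swY) + mkq b 0 0 0 (q3 v) ⊗ 1).
Proof.
rewrite /quat_coact /= /quat_gen /= hatXY /hatX /hatY !mulrDr !tens1M.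
by rewrite quat_xy !quat_baseMl /= !mulr0 !mulr1.
Qed.

Let mk0 : mkq b 0 0 0 0 = 0. Proof. by []. Qed.
Let e0 c : quat_coact (mkq b c 0 0 0) = mkq b c 0 0 0 ⊗ 1.
Proof. by rewrite quat_coactE /= !mk0 !tensor0l !addr0. Qed.
Let e1 c : quat_coact (mkq b 0 c 0 0) = mkq b 0 c 0 0 ⊗ swX.
Proof. by rewrite quat_coactE /= !mk0 !tensor0l !addr0 add0r. Qed.
Let e2 c : quat_coact (mkq b 0 0 c 0) = mkq b c 0 0 0 ⊗ swY + mkq b 0 0 c 0 ⊗ swX.
Proof. by rewrite quat_coactE /= !mk0 !tensor0l !addr0 add0r. Qed.
Lemma quat_coact_x : quat_coact (quat_x b) = quat_x b ⊗ swX.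
Proof. exact: e1. Qed.
Lemma quat_coact_y : quat_coact (quat_y b) = 1 ⊗ swY + quat_y b ⊗ swX.
Proof. exact: e2. Qed.
Let e3 c : quat_coact (mkq b 0 0 0 c) = mkq b 0 c 0 0 ⊗ (swX * swY) + mkq b 0 0 0 c ⊗ 1.
Proof. by rewrite quat_coactE /= !mk0 !tensor0l !addr0 add0r. Qed.

Let quat_split (v : Q) : v = mkq b (q0 v) 0 0 0 + mkq b 0 (q1 v) 0 0
  + mkq b 0 0 (q2 v) 0 + mkq b 0 0 0 (q3 v).
Proof. by rewrite !mkqD !(addr0, add0r) -mkqE. Qed.

Let coactL : linear quat_coact. Proof. by move=> c u v; rewrite linearP. Qed.
Let comulL := comul_linear H.
Let counitL : scalar (@counit k H) := counit_linear H.

Lemma quat_coactA v : tensor_map quat_coact id (quat_coact v) =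
  tensor_assoc (tensor_map id (@comul _ H) (quat_coact v)).
Proof.
have L1 : {morph tensor_map quat_coact (id : H -> H) : x y / x + y} by exact: tensor_mapD.
have L2 : {morph tensor_map (id : Q -> Q) (@comul _ H) : x y / x + y} by exact: tensor_mapD.
have L3 := @tensor_assocD k Q H H.
have E1 u h : tensor_map quat_coact id (u ⊗ h) = quat_coact u ⊗ h by rewrite tensor_mapE.
have E2 u h : tensor_map id (@comul _ H) (u ⊗ h) = u ⊗ comul h by rewrite tensor_mapE.
have E3 u g h := @tensor_assocE k Q H H u g h.
rewrite (quat_split v) !(linD coactL) !e0 !e1 !e2 !e3 !L1 !L2 !L3 !E1 !E2.
rewrite !comul1 !comul_swX !comul_swY !comul_swXY !e0 !e1 !e2 !e3.
by rewrite !tensorDr !tensorDl !L3 !E3 !addrA.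
Qed.

Lemma quat_coact_counit v :
  tensor_lift (fun a h => counit h *: a) (quat_coact v) = v.
Proof.
rewrite -[LHS]/(slice sw_counit _) [in RHS](quat_split v) quat_coactE.
rewrite !linearD /= !sliceE /= !sw_counitE.
by rewrite !scale1r !scale0r !add0r.
Qed.

Let coactM : monoid_morphism quat_coact.
Proof. by split=> [|u v]; [exact: rmorph1|exact: rmorphM]. Qed.

Definition quat_comod : comodAlg H :=
  ComodAlg coactL coactM quat_coactA quat_coact_counit.

(** The coaction of v has X-component q1 x + q2 y and XY-component q3 x; both vanish when v is
    coinvariant, leaving only q0. *)
Lemma quat_coinv (v : Q) : quat_coact v = v ⊗ 1 <-> exists c, quat_base b c = v.
Proof.
split=> [e|[c <-]]; last exact: e0.
exists (q0 v).
have sl f := congr1 (slice f) (etrans (esym (quat_coactE v)) e).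
have := sl swX_coord; rewrite !linearD /= !sliceE /= !swX_coordE.
rewrite !(scale0r, scale1r, addr0, add0r) mkqD !addr0 add0r => -[v1 v2].
have := sl swXY_coord; rewrite !linearD /= !sliceE /= !swXY_coordE.
rewrite !(scale0r, scale1r, addr0, add0r) => -[v3].
by rewrite /quat_base [RHS]mkqE v1 v2 v3.
Qed.

End QuatComod.

(** * Faithful flatness and the Galois property: [quat b] is a bundle *)

(** With a finite basis [e] and coordinates [pr], M ⊗ N is a finite direct sum of copies of M on
    which f ⊗ id acts as f on each copy, so exactness can be tested copy by copy. *)
Lemma free_faithfully_flat (C : comNzRingType) (N : zmodType)
    (la : C -> N -> N) (n : nat) (e : 'I_n.+1 -> N) (pr : 'I_n.+1 -> N -> C) :
  (forall i, {morph pr i : u v / u + v}) ->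
  (forall i c u, pr i (la c u) = c * pr i u) ->
  (forall i j, pr i (e j) = (i == j)%:R) ->
  (forall u, u = \sum_i la (pr i u) (e i)) ->
  faithfully_flat la.
Proof.
move=> prD prZ pre decomp M1 M2 M3 f g tensN.
pose co (M : lmodType C) i (z : tensN M) : M :=
  tlift (fun (m : M) (u : N) => pr i u *: m) z.
have cobal (M : lmodType C) i : balanced (fun (m : M) (c : C) => c *: m) la
    (fun (m : M) u => pr i u *: m).
  split=> [m m' u|m u v|m c u]; first by rewrite scalerDr.
    by rewrite prD scalerDl.
  by rewrite prZ scalerA mulrC.
have coE (M : lmodType C) i (m : M) u : co M i (tpure m u) = pr i u *: m.
  exact: tliftE.
have coD (M : lmodType C) i : {morph co M i : x y / x + y}.
  by move=> x y; apply: tliftD.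
have tsum (M : lmodType C) (z : tensN M) : z = \sum_i tpure (co M i z) (e i).
  move: z; apply: tens_ext => [//|x y|m u].
    by rewrite -big_split /=; apply: eq_bigr => i _; rewrite coD tpureDl.
  under eq_bigr do rewrite coE tpure_bal.
  rewrite [in LHS](decomp u).
  apply: (big_morph (fun v => tpure m v : tensN M)) => [v w|].
    exact: tpureDr.
  exact: tpure0r.
have tmapfE (M M' : lmodType C) (h : {linear M -> M'}) m u :
    tmap h id (tpure m u : tensN M) = (tpure (h m) u : tensN M').
  apply: tmapE => // [x y|m' c v]; first by rewrite linearD.
  by rewrite linearZ tpure_bal.
have tmapfD (M M' : lmodType C) (h : {linear M -> M'}) :
    {morph (tmap h id : tensN M -> tensN M') : x y / x + y}.
  apply: tmapD => // [x y|m' c v]; first by rewrite linearD.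
  by rewrite linearZ tpure_bal.
have co_tmap (M M' : lmodType C) (h : {linear M -> M'}) i (z : tensN M) :
    co M' i (tmap h id z) = h (co M i z).
  move: z; apply: tens_ext => [x y|x y|m u].
  - by rewrite tmapfD coD.
  - by rewrite coD linearD.
  - by rewrite tmapfE !coE linearZ.
have co0 (M : lmodType C) i : co M i 0 = 0 by apply/morphD0/coD.
have coe (M : lmodType C) (m : M) : co M ord0 (tpure m (e ord0)) = m.
  by rewrite coE pre eqxx scale1r.
split=> ex y.
- split=> [gy|[x <-]].
    have exi i : exists x, f x = co M2 i y.
      by apply: (proj1 (ex _)); rewrite -co_tmap gy co0.
    have [x fx] := choice exi.
    exists (\sum_i tpure (x i) (e i)).
    rewrite (big_morph _ (tmapfD _ _ f) (morphD0 (tmapfD _ _ f))).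
    by rewrite [RHS]tsum; apply: eq_bigr => i _; rewrite tmapfE fx.
  rewrite [LHS]tsum big1 // => i _; rewrite !co_tmap.
  have -> : g (f (co M1 i x)) = 0 by apply: (proj2 (ex _)); exists (co M1 i x).
  exact: tpure0l.
(* To reflect exactness, M is recovered from M ⊗ N as the coordinate of index 0, which exists
   because the basis has n.+1 elements. *)
- split=> [gy|[x <-]].
    have [|x fx] := proj1 (ex (tpure y (e ord0))); first by rewrite tmapfE gy tpure0l.
    by exists (co M1 ord0 x); rewrite -co_tmap fx coe.
  rewrite -(coe _ x) -!co_tmap.
  have -> : tmap g id (tmap f id (tpure x (e ord0) : tensN M1) : tensN M2) = 0 :> tensN M3.
    by apply: (proj2 (ex _)); exists (tpure x (e ord0)).
  exact: co0.
Qed.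

Section QuatBundle.
Variables (k : fieldType) (K : comAlgType k) (b : K).
Local Notation H := (H4_hopf k).
Local Notation Q := (quat b).
Local Notation x := (quat_x b).
Local Notation y := (quat_y b).
Local Notation base := (quat_base b).

Lemma quat_decomp (v : Q) :
  v = base (q0 v) + base (q1 v) * x + base (q2 v) * y + base (q3 v) * (x * y).
Proof.
rewrite quat_xy !quat_baseMl !mkqD /= !mulr0 !mulr1 !(addr0, add0r); exact: mkqE.
Qed.

Let T := tens (fun (a : Q) (c : K) => a * base c)
  (fun (c : K) (v : Q) => base c * v).

Let gal : T -> tensor Q H := @galois_map k H K (quat_comod b) (quat_base b).
Let gal_balanced : balanced (fun (a : Q) (c : K) => a * base c)
  (fun (c : K) (v : Q) => base c * v) (fun a v => tens1 a * quat_coact b v).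
Proof.
split=> [u v w|u v w|u c v]; first by rewrite raddfD mulrDl.
  by rewrite raddfD mulrDr.
rewrite !rmorphM -mulrA; congr (_ * (_ * _)).
by symmetry; apply/quat_coinv; exists c.
Qed.
Let galE u v : gal (tpure u v) = tens1 u * quat_coact b v.
Proof. exact: (tliftE gal_balanced). Qed.
Let galD : {morph gal : u v / u + v}.
Proof. by move=> u v; apply: (tliftD gal_balanced). Qed.

(* The canonical map sends x ⊗ x to 1 ⊗ X, 1 ⊗ y - yx ⊗ x to 1 ⊗ Y and        *)
(* x ⊗ xy - y ⊗ 1 to 1 ⊗ XY, which dictates its inverse.                      *)
Lemma quat_galois : bijective (@galois_map k H K (quat_comod b) (quat_base b)).
Proof.
pose inv (t : tensor Q H) : T :=
  tpure (slice sw1_coord t - slice swXY_coord t * y) 1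
  + tpure (slice swX_coord t * x - slice swY_coord t * (y * x)) x
  + tpure (slice swY_coord t) y + tpure (slice swXY_coord t * x) (x * y).
have coactx : quat_coact b x = hatX x by exact: quat_coact_x.
have coacty : quat_coact b y = hatY y by exact: quat_coact_y.
have invD : {morph inv : s t / s + t}.
  move=> s t; rewrite /inv.
  have -> : slice sw1_coord (s + t) - slice swXY_coord (s + t) * y =
      slice sw1_coord s - slice swXY_coord s * y
      + (slice sw1_coord t - slice swXY_coord t * y).
    by rewrite !linearD mulrDl opprD addrACA.
  have -> : slice swX_coord (s + t) * x - slice swY_coord (s + t) * (y * x) =
      slice swX_coord s * x - slice swY_coord s * (y * x)
      + (slice swX_coord t * x - slice swY_coord t * (y * x)).
    by rewrite !linearD !mulrDl opprD addrACA.
  rewrite !linearD mulrDl !tpureDl !addrA.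
  by rewrite [LHS](ACl (1*2*5*6*9*11*3*4*7*8*10*12)).
have coactxy : quat_coact b (x * y) = hatX x * hatY y.
  by rewrite -coactx -coacty; apply: rmorphM.
have coact1 : quat_coact b 1 = 1 by exact: rmorph1.
exists inv; rewrite -/gal.
- apply: tens_ext => [u v|//|u v]; first by rewrite galD invD.
  rewrite galE.
  have -> : tens1 u * quat_coact b v =
      (u * base (q0 v) + u * base (q3 v) * (x * y)) ⊗ 1
      + (u * base (q1 v) * x + u * base (q2 v) * y) ⊗ swX
      + (u * base (q2 v)) ⊗ swY + (u * base (q3 v) * x) ⊗ (swX * swY).
    rewrite quat_coactE !mulrDr !tens1M -!mulrA quat_xy !quat_baseMl /= !mulr0 !mulr1.
    by rewrite !tensorDl !addrA [LHS](ACl (1*6*2*4*3*5)).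
  rewrite /inv !linearD /= !sliceE /= !sw1_coordE !swX_coordE !swY_coordE !swXY_coordE.
  rewrite !(scale0r, scale1r, addr0, add0r).
  have -> : u * base (q0 v) + u * base (q3 v) * (x * y) - u * base (q3 v) * x * y
    = u * base (q0 v) by rewrite [u * base (q3 v) * (x * y)]mulrA addrK.
  have -> : (u * base (q1 v) * x + u * base (q2 v) * y) * x - u * base (q2 v) * (y * x)
    = u * base (q1 v).
    by rewrite mulrDl [u * base (q2 v) * (y * x)]mulrA addrK -mulrA quat_xx mulr1.
  have -> : u * base (q3 v) * x * x = u * base (q3 v).
    by rewrite -mulrA quat_xx mulr1.
  rewrite [in RHS](quat_decomp v) -[base (q0 v) in RHS]mulr1 !tpureDr.
  by rewrite !(@tpure_bal _ _ _ (fun (a : Q) (c : K) => a * base c)).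
- move=> t; rewrite !galD !galE coactxy coactx coacty coact1 mulr1.
  rewrite [in RHS](tensor_sliceE t).
  move: (slice sw1_coord t) (slice swX_coord t).
  move: (slice swY_coord t) (slice swXY_coord t).
  move=> r w p q; rewrite hatXY /hatX /hatY !mulrDr !tens1M mulr1.
  have -> : (q * x - r * (y * x)) * x = q - r * y.
    by rewrite mulrBl -!mulrA quat_xx !mulr1.
  have -> : w * x * x = w by rewrite -mulrA quat_xx mulr1.
  have -> : w * x * (x * y) = w * y.
    by rewrite -mulrA [x * (x * y)]mulrA quat_xx mul1r.
  rewrite /tens1 !tensorDl !pureNl !addrA [LHS](ACl ((1*3*5*7)*(2*8)*(4*6))) /=.
  by rewrite !addNr !addr0.
Qed.

Definition quat_pr (i : 'I_4) (v : Q) : K := [:: q0 v; q1 v; q2 v; q3 v]`_i.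
Definition quat_basis (i : 'I_4) : Q := [:: 1; x; y; x * y]`_i.

Lemma quat_flat : faithfully_flat (fun c (v : quat_comod b) => base c * v).
Proof.
apply: (@free_faithfully_flat K Q _ 3 quat_basis quat_pr).
- by case=> [] [|[|[|[|]]]].
- move=> i c u; rewrite quat_baseMl.
  by case: i => [] [|[|[|[|]]]].
- by do 2![case=> [] [|[|[|[|]]]] // ?]; rewrite /quat_pr /quat_basis quat_xy.
move=> u; rewrite !big_ord_recl big_ord0 addr0 /= !addrA mulr1; exact: quat_decomp.
Qed.

Definition quat_bundle : bundle H K :=
  @Bundle k H K (quat_comod b) (quat_base b)
    (fun c d e => congr1 q0 e) (@quat_coinv k K b) (@quat_base_central k K b)
    quat_galois quat_flat.

End QuatBundle.

(** * Isomorphisms of comodule algebras, and recognising [quat b] *)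

Section Iso.
Variables (k : fieldType) (H : hopfAlg k).
Implicit Types A B D : comodAlg H.

Lemma comodAlg_iso_sym A B : comodAlg_iso A B -> comodAlg_iso B A.
Proof.
move=> [F [[G FK GK] Fco]].
have GL : linear G by exact: can2_linear FK GK.
have GM : monoid_morphism G by exact: can2_monoid_morphism FK GK.
pose GR : {lrmorphism B -> A} :=
  HB.pack G (GRing.isLinear.Build k B A *:%R G GL)
            (GRing.isMonoidMorphism.Build B A G GM).
exists GR; split=> [|b]; first by exists F.
rewrite /= -[in RHS](GK b) Fco.
have FL : linear F by move=> c u v; rewrite linearP.
move: (coact (G b)); apply: tensor_ext => [//|u v|a h].
  by rewrite !(tensor_mapD FL, tensor_mapD GL).
by rewrite !tensor_mapE ?FK.
Qed.

Lemma comodAlg_iso_trans A B D :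
  comodAlg_iso A B -> comodAlg_iso B D -> comodAlg_iso A D.
Proof.
move=> [F [Fbij Fco]] [G [Gbij Gco]].
exists (G \o F); split=> [|a]; first exact: bij_comp.
have FL : linear F by move=> c u v; rewrite linearP.
have GL : linear G by move=> c u v; rewrite linearP.
have GFL : linear (G \o F) by move=> c u v; rewrite linearP.
rewrite /= Gco Fco.
move: (coact a); apply: tensor_ext => [u v|u v|b h].
- by rewrite !(tensor_mapD FL, tensor_mapD GL).
- by rewrite (tensor_mapD GFL).
by rewrite !tensor_mapE.
Qed.
End Iso.

Section QuatIso.
Variables (k : fieldType) (K : comAlgType k) (b : K).
Local Notation H := (H4_hopf k).
Variables (A : comodAlg H) (J : {lrmorphism K -> A}) (x y : A).
Hypothesis JC : forall c a, J c * a = a * J c.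
Hypotheses (xx : x * x = 1) (yy : y * y = J b) (yx : y * x = - (x * y)).
Hypothesis Jco : forall c, coact (J c) = J c ⊗ 1.
Hypotheses (xco : coact x = x ⊗ swX) (yco : coact y = 1 ⊗ swY + y ⊗ swX).

(** The relations make [quat_gen] an algebra morphism, and the prescribed coactions of J c, x and y
    make it colinear, since those of A and of [quat b] agree on generators. *)
Lemma quat_comod_iso :
  bijective (@quat_gen _ _ b _ J x y) -> comodAlg_iso (quat_comod b) A.
Proof.
move=> genbij; exists (quat_mor JC xx yy yx); split=> // v.
have gL := @quat_gen_linear _ _ b _ J x y.
have idL : linear (id : H -> H) by [].
have mD := tensor_mapD gL idL.
rewrite [coact v]quat_coactE !mD !tensor_mapE //.
rewrite -[quat_mor _ _ _ _ v]/(quat_gen J x y v) /quat_gen /=.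
have cD := linD (coact_linear A); have cM := (coact_monoid A).2.
rewrite !cD !cM !Jco xco yco -/(tens1 _) -/(hatX x) -/(hatY y) hatXY.
rewrite -!/(tens1 _) /hatX /hatY !mulrDr !tens1M.
by rewrite !rmorph0 !mul0r !(addr0, add0r) mulr1.
Qed.
End QuatIso.

Section Trivial.
Variables (k : fieldType) (C : comAlgType k).
Local Notation H := (H4_hopf k).

(** For b = 0 the defining relations are those of X and Y in H_4, so 1 ⊗ X and 1 ⊗ Y serve as x and
    y; the inverse map reads coordinates along the basis of H_4. *)
Lemma quat0_trivial : trivial_bundle (quat_bundle (0 : C)).
Proof.
pose J : {lrmorphism C -> tensor C H} := @tens1 k C.
pose x : tensor C H := 1 ⊗ swX.
pose y : tensor C H := 1 ⊗ swY.
have genE (v : quat (0 : C)) : quat_gen J x y v =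
    q0 v ⊗ 1 + q1 v ⊗ swX + q2 v ⊗ swY + q3 v ⊗ (swX * swY).
  rewrite /quat_gen /= !tens1M !mulr1.
  have -> : x * y = 1 ⊗ (swX * swY) by rewrite [LHS]tensorM mulr1.
  by rewrite tens1M mulr1.
apply: (@quat_comod_iso _ _ _ (trivial_comodAlg H C) J x y).
- move=> c a; elim/tensor_ind: a => [|d h|s t IHs IHt]; first by rewrite mulr0 mul0r.
    by rewrite [LHS]tensorM [RHS]tensorM mulr1 mul1r mulrC.
  by rewrite mulrDr mulrDl IHs IHt.
- by rewrite [LHS]tensorM mulr1 swXX.
- by rewrite [LHS]tensorM swYY tensor0r rmorph0.
- by rewrite ![_ * _ in RHS]tensorM [LHS]tensorM swYX mulr1 pureNr.
- move=> c; rewrite [LHS]triv_coactE comul1; exact: tensor_assocE.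
- rewrite [LHS]triv_coactE comul_swX; exact: tensor_assocE.
- have TD (u v : tensor H H) :
      triv_pure (1 : C) (u + v) = triv_pure 1 u + triv_pure 1 v.
    by rewrite /triv_pure tensorDr; apply: tensor_assocD.
  rewrite [LHS]triv_coactE comul_swY TD.
  by congr (_ + _); apply: tensor_assocE.
pose inv (t : tensor C H) := mkq (0 : C) (slice sw1_coord t) (slice swX_coord t)
  (slice swY_coord t) (slice swXY_coord t).
exists inv => [v|t]; last by rewrite genE /= -tensor_sliceE.
rewrite genE /inv !linearD /= !sliceE /= !sw1_coordE !swX_coordE !swY_coordE !swXY_coordE.
by rewrite !(scale0r, scale1r, addr0, add0r) -mkqE.
Qed.
End Trivial.

(** * The basis 1, x, y, xy of a bundle with suitable x and y *)

Section Basis.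
Variables (k : fieldType) (C : comAlgType k).
Local Notation H := (H4_hopf k).
Variable A : bundle H C.
Variables (x x' y : A).
Hypotheses (xx' : x * x' = 1) (x'x : x' * x = 1).
Hypotheses (xco : coact x = x ⊗ swX) (yco : coact y = 1 ⊗ swY + y ⊗ swX).

(** [coact a'] is inverse to [coact a], and a' ⊗ g is an inverse of a ⊗ g because g^2 = 1. *)
Lemma coact_inv (g : H) (a a' : A) :
  g * g = 1 -> a * a' = 1 -> a' * a = 1 -> coact a = a ⊗ g -> coact a' = a' ⊗ g.
Proof.
move=> gg aa' a'a ca; have [c1 cM] := coact_monoid A.
have e : a ⊗ g * (a' ⊗ g) = 1 by rewrite tensorM aa' gg.
by rewrite -[LHS]mulr1 -e mulrA -ca -cM a'a c1 mul1r.
Qed.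

Lemma coact_base c : coact (base A c) = base A c ⊗ 1.
Proof. by apply/base_coinv; exists c. Qed.

Local Notation co1 a := (slice sw1_coord (coact a)).
Local Notation coX a := (slice swX_coord (coact a)).
Local Notation coY a := (slice swY_coord (coact a)).
Local Notation coXY a := (slice swXY_coord (coact a)).

(** Coassociativity with the last factor of A ⊗ H ⊗ H contracted by f, after expanding the
    coproducts of 1, X, Y and XY. *)
Let slice_coact f (a : A) : coact (slice f (coact a)) =
  slice f ((co1 a ⊗ 1) ⊗ (1 : H) + (coX a ⊗ swX) ⊗ (swX : H)
    + ((coY a ⊗ 1) ⊗ (swY : H) + (coY a ⊗ swY) ⊗ (swX : H))
    + ((coXY a ⊗ swX) ⊗ (swX * swY : H) + (coXY a ⊗ (swX * swY)) ⊗ (1 : H))).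
Proof.
rewrite -(slice_map f (coact a) (coact_linear A)) coactA; congr slice.
have mL : linear (tensor_map (id : A -> A) (@comul _ H)).
  by apply: tensor_map_linear => //; apply: comul_linear.
have aD := @tensor_assocD k A H H.
rewrite [in LHS](tensor_sliceE (coact a)) !(linD mL) !aD.
rewrite !tensor_mapE; try exact: comul_linear; try by [].
rewrite comul1 comul_swX comul_swY comul_swXY !tensorDr !aD.
by rewrite !tensor_assocE.
Qed.

Let sE := (sw1_coordE, swX_coordE, swY_coordE, swXY_coordE).
Let coact_1 (a : A) : coact (co1 a) = co1 a ⊗ 1 + coXY a ⊗ (swX * swY).
Proof.
rewrite slice_coact !linearD /= !sliceE /= !sE.
by rewrite !(scale0r, scale1r, addr0, add0r).
Qed.
Let coact_X (a : A) : coact (coX a) = coX a ⊗ swX + coY a ⊗ swY.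
Proof.
rewrite slice_coact !linearD /= !sliceE /= !sE.
by rewrite !(scale0r, scale1r, addr0, add0r).
Qed.
Let coact_Y (a : A) : coact (coY a) = coY a ⊗ 1.
Proof.
rewrite slice_coact !linearD /= !sliceE /= !sE.
by rewrite !(scale0r, scale1r, addr0, add0r).
Qed.
Let coact_XY (a : A) : coact (coXY a) = coXY a ⊗ swX.
Proof.
rewrite slice_coact !linearD /= !sliceE /= !sE.
by rewrite !(scale0r, scale1r, addr0, add0r).
Qed.

Let cD := linD (coact_linear A).
Let cM := (coact_monoid A).2.
Let jM c (a : A) (h : H) : (base A c ⊗ 1) * (a ⊗ h) = (base A c * a) ⊗ h.
Proof. exact: tens1M. Qed.

(* By coassociativity, the components of coact a = a_1 ⊗ 1 + a_X ⊗ X +        *)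
(* a_Y ⊗ Y + a_XY ⊗ XY are such that a_Y and x^-1 a_XY are coinvariant, and   *)
(* then so are a_1 - a_XY y and (a_X - a_Y y) x^-1; finally a = a_1 + a_X.    *)
Lemma sweedler_basis_span (a : A) : exists c0 c1 c2 c3 : C,
  a = base A c0 + base A c1 * x + base A c2 * y + base A c3 * (x * y).
Proof.
have x'co : coact x' = x' ⊗ swX by apply: coact_inv xco; rewrite ?swXX.
have [c3 c3E] : exists c, base A c = x' * coXY a.
  by apply/base_coinv; rewrite cM x'co coact_XY tensorM swXX.
have [c2 c2E] : exists c, base A c = coY a by apply/base_coinv/coact_Y.
have aXY : coXY a = base A c3 * x by rewrite base_central c3E mulrA xx' mul1r.
have cN u : coact (- u : A) = - coact u by apply: (morphDN cD).
have [c0 c0E] : exists c, base A c = co1 a - base A c3 * (x * y).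
  apply/base_coinv; rewrite cD cN coact_1 aXY !cM coact_base xco yco.
  rewrite -/(hatX x) -/(hatY y) hatXY mulrDr !jM tensorDl pureNl opprD.
  by rewrite !addrA [LHS](ACl ((1*4)*(2*3))) /= subrr addr0.
have [c1 c1E] : exists c, base A c = (coX a - base A c2 * y) * x'.
  apply/base_coinv; rewrite cM cD cN coact_X cM coact_base yco x'co.
  rewrite -c2E mulrDr !jM mulr1 opprD addrA -(addrA _ (_ ⊗ swY)) subrr addr0.
  by rewrite -pureNl -tensorDl tensorM swXX.
exists c0, c1, c2, c3.
rewrite c0E c1E -[_ * x' * x]mulrA x'x mulr1 c2E.
rewrite !addrA [RHS](ACl ((1*3)*(5*4)*(2*6))) /= subrr addNr !addr0.
rewrite -[LHS](coact_counit a) -[LHS]/(slice sw_counit _).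
rewrite [in LHS](tensor_sliceE (coact a)) !linearD /= !sliceE /= !sw_counitE.
by rewrite !scale1r !scale0r !addr0.
Qed.

(** The coaction of the relation has XY-component c3 x, Y-component c2 and X-component c1 x + c2 y.
    Read in this order, x being invertible, they kill c3, c2 and c1, and then c0 = 0 is left. *)
Lemma sweedler_basis_free (c0 c1 c2 c3 : C) :
  base A c0 + base A c1 * x + base A c2 * y + base A c3 * (x * y) = 0 ->
  [/\ c0 = 0, c1 = 0, c2 = 0 & c3 = 0].
Proof.
have base0 c : base A c = 0 -> c = 0.
  by move=> e; apply: (base_inj (b := A)); rewrite e rmorph0.
move=> e0.
have e : base A c0 ⊗ 1 + (base A c1 * x) ⊗ swX
    + (base A c2 ⊗ swY + (base A c2 * y) ⊗ swX)
    + ((base A c3 * x) ⊗ (swX * swY) + (base A c3 * (x * y)) ⊗ 1) = 0 :> tensor A H.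
  have := congr1 (@coact _ _ A) e0; rewrite (morphD0 cD) => <-.
  rewrite !cD !cM !coact_base xco yco -/(hatX x) -/(hatY y) hatXY /hatX /hatY.
  by rewrite !mulrDr !jM mulr1.
have sl f := etrans (congr1 (slice f) e) (raddf0 _).
have := sl swXY_coord; rewrite !linearD /= !sliceE /= !swXY_coordE.
rewrite !(scale0r, scale1r, addr0, add0r) => /(congr1 ( *%R^~ x')).
rewrite mul0r -mulrA xx' mulr1 => /base0 c3z.
have := sl swY_coord; rewrite !linearD /= !sliceE /= !swY_coordE.
rewrite !(scale0r, scale1r, addr0, add0r) => /base0 c2z.
have := sl swX_coord; rewrite !linearD /= !sliceE /= !swX_coordE.
rewrite !(scale0r, scale1r, addr0, add0r) c2z rmorph0 mul0r addr0.
move=> /(congr1 ( *%R^~ x')); rewrite mul0r -mulrA xx' mulr1 => /base0 c1z.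
move: e0; rewrite c1z c2z c3z rmorph0 !mul0r !addr0 => /base0 c0z.
by split.
Qed.

(** Only the module structure matters here: the underlying module of [quat b] is the same for all b,
    and the map is bijective because 1, x, y, xy is a basis. *)
Lemma sweedler_gen_bij b : bijective (@quat_gen k C b A (base A) x y).
Proof.
have gL := @quat_gen_linear k C b A (base A) x y.
have gen0 v : quat_gen (base A) x y v = 0 -> v = 0 :> quat b.
  by move=> /sweedler_basis_free [v0 v1 v2 v3]; rewrite (mkqE v) v0 v1 v2 v3.
have genP a : exists v : quat b, quat_gen (base A) x y v = a.
  by have [c0 [c1 [c2 [c3 ->]]]] := sweedler_basis_span a; exists (mkq b c0 c1 c2 c3).
have [g gK] := choice genP.
exists g => // v; apply/eqP; rewrite -subr_eq0; apply/eqP/gen0.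
by rewrite (linD gL) (morphDN (linD gL)) gK subrr.
Qed.

End Basis.

(** * Push-forwards as members of the family *)

Section PushforwardQuat.
Variables (k : fieldType) (C C' : comAlgType k) (f : {lrmorphism C -> C'}).
Local Notation H := (H4_hopf k).

Definition pf_in (A : bundle H C) (c : C') : pushfwd f A := pf_pure f c (1 : A).

Section PfIn.
Variable A : bundle H C.
Let in_linear : linear (@pf_in A).
Proof. by move=> c u v; rewrite /pf_in pf_pureDl pf_pureZl. Qed.
HB.instance Definition _ :=
  GRing.isLinear.Build k C' (pushfwd f A) *:%R (@pf_in A) in_linear.
Let in_monoid : monoid_morphism (@pf_in A).
Proof. by split=> // u v; rewrite /pf_in pf_pureM mulr1. Qed.
HB.instance Definition _ :=
  GRing.isMonoidMorphism.Build C' (pushfwd f A) (@pf_in A) in_monoid.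
End PfIn.

(* s = sqrt (f a), so that x / s squares to 1 after base change. *)
Lemma pushforward_quat (A : bundle H C) (x x' y : A) (a b : C) (s s' : C') :
  x * x' = 1 -> x' * x = 1 ->
  coact x = x ⊗ swX -> coact y = 1 ⊗ swY + y ⊗ swX ->
  x * x = base A a -> y * y = base A b -> y * x = - (x * y) ->
  s * s' = 1 -> s * s = f a ->
  comodAlg_iso (quat_comod (f b)) (pushforward f A).
Proof.
move=> xx' x'x xco yco xx yy yx ss' ssa.
pose J : {lrmorphism C' -> pushfwd f A} := @pf_in A.
pose X := pf_pure f s' x; pose Y := pf_pure f 1 y.
have XY : X * Y = pf_pure f s' (x * y) by rewrite pf_pureM mulr1.
have JM c d z : J c * pf_pure f d z = pf_pure f (c * d) z.
  by rewrite [LHS]pf_pureM mul1r.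
(* [g] gives the coordinates of an element of A over C. Here [quat b] is used as a module only,
   since x^2 is a in A and not 1. *)
have [g genK gK] := sweedler_gen_bij xx' x'x xco yco b.
set gen := quat_gen _ _ _ in genK gK.
have genD : {morph gen : u v / u + v} by apply/linD/quat_gen_linear.
have genB c v : gen (quat_base b c * v) = base A c * gen v.
  by rewrite quat_baseMl /gen /quat_gen /= !rmorphM !mulrDr !mulrA.
have gD : {morph g : u v / u + v}.
  by move=> u v; apply: (can_inj genK); rewrite gK genD !gK.
have gB c u : g (base A c * u) = quat_base b c * g u.
  by apply: (can_inj genK); rewrite gK genB gK.
(* The inverse map: since x = s X, the coordinates along x and xy are multiplied by s, those along 1
   and y are kept. *)
pose h (c : C') (u : A) := mkq (f b) (c * f (q0 (g u))) (c * s * f (q1 (g u)))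
  (c * f (q2 (g u))) (c * s * f (q3 (g u))).
have hbal : balanced (fun (c' : C') (c : C) => f c * c')
    (fun c (u : A) => base A c * u) h.
  split=> [c d u|c u v|c r u]; rewrite /h.
  - by rewrite mkqD -!mulrDl.
  - by rewrite gD mkqD /= !rmorphD -!mulrDr.
  - by rewrite gB quat_baseMl /= !rmorphM; congr mkq; ring.
pose G : pushfwd f A -> quat (f b) := tlift h.
have GE c u : G (pf_pure f c u) = h c u by exact: (tliftE hbal).
have GD : {morph G : u v / u + v} by move=> u v; apply: (tliftD hbal).
have g1 : g 1 = mkq b 1 0 0 0.
  by apply: (can_inj genK); rewrite gK /gen /quat_gen /= rmorph1 rmorph0 !mul0r !addr0.
have gx : g x = mkq b 0 1 0 0.
  by apply: (can_inj genK); rewrite gK /gen /quat_gen /= rmorph1 rmorph0 !mul0r mul1r add0r !addr0.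
have gy : g y = mkq b 0 0 1 0.
  by apply: (can_inj genK); rewrite gK /gen /quat_gen /= rmorph1 rmorph0 !mul0r mul1r !add0r addr0.
have gxy : g (x * y) = mkq b 0 0 0 1.
  by apply: (can_inj genK); rewrite gK /gen /quat_gen /= rmorph1 rmorph0 !mul0r mul1r !add0r.
have genE v : quat_gen J X Y v = pf_pure f (q0 v) 1 + pf_pure f (q1 v * s') x
    + pf_pure f (q2 v) y + pf_pure f (q3 v * s') (x * y).
  by rewrite /quat_gen XY !JM mulr1.
have ss'r c : c * s' * s = c by rewrite -mulrA [s' * s]mulrC ss' mulr1.
have pfb c d (u : A) : pf_pure f (c * f d) u = pf_pure f c (base A d * u).
  by rewrite mulrC pf_bal.
apply: (@quat_comod_iso _ _ _ (pushforward f A) J X Y).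
- move=> c; apply: pf_ext => [u v|u v|d u]; rewrite ?mulrDr ?mulrDl //.
  by rewrite JM [RHS]pf_pureM mulr1 mulrC.
- rewrite [LHS]pf_pureM xx -[base A a]mulr1 -pf_bal -ssa.
  have -> : s * s * (s' * s') = (s * s') * (s * s') by ring.
  by rewrite ss' mulr1.
- by rewrite [LHS]pf_pureM yy mulr1 -[base A b]mulr1 -pf_bal mulr1.
- by rewrite XY [LHS]pf_pureM mul1r yx (morphDN (pf_pureDr _ _)).
- move=> c; rewrite [LHS]pf_coactE (coact_monoid A).1.
  by rewrite tensor_mapE //; apply: pf_pure_linear.
- by rewrite [LHS]pf_coactE xco tensor_mapE //; apply: pf_pure_linear.
- have pL := @pf_pure_linear k H C C' f A 1.
  by rewrite [LHS]pf_coactE yco (tensor_mapD pL) ?tensor_mapE.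
exists G => [v|].
  rewrite genE !GD !GE /h g1 gx gy gxy !mkqD /= !rmorph0 !rmorph1 !mulr0 !mulr1 !ss'r.
  by rewrite !(addr0, add0r) -mkqE.
have genJD : {morph (@quat_gen _ _ (f b) _ J X Y) : u v / u + v}.
  by apply/linD/quat_gen_linear.
apply: pf_ext => [u v|//|c u]; first by rewrite GD genJD.
have ss'rr d e : d * s * e * s' = d * e.
  by rewrite mulrAC -[d * s * s']mulrA ss' mulr1.
rewrite GE genE /h /= !ss'rr !pfb -!pf_pureDr.
by rewrite -[u in RHS]gK /gen /quat_gen mulr1.
Qed.

(** In [quat b] already x^2 = 1, so [pushforward_quat] applies with a = s = s' = 1. *)
Lemma pushforward_quat_bundle (b : C) :
  comodAlg_iso (quat_comod (f b)) (pushforward f (quat_bundle b)).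
Proof.
apply: (@pushforward_quat (quat_bundle b) (quat_x b) (quat_x b) (quat_y b)
  1 b 1 1);
  rewrite ?mulr1 ?rmorph1 //.
- exact: quat_xx.
- exact: quat_xx.
- exact: quat_coact_x.
- exact: quat_coact_y.
- exact: quat_xx.
- exact: quat_yy.
- exact: quat_yx.
Qed.
End PushforwardQuat.

(** * Generators from a cleaving map, and the homotopy *)

Section Cleft.
Variables (k : fieldType) (C : comAlgType k).
Local Notation H := (H4_hopf k).

(** On a grouplike element the Sweedler sum has a single term, so a convolution inverse yields an
    ordinary one; used for 1 and X, on both sides. *)
Lemma conv_grouplike (A : comodAlg H) (g g' : {linear H -> A}) (h : H) :
  comul h = h ⊗ h -> counit h = 1 ->
  (forall h, tensor_lift (fun h1 h2 => g h1 * g' h2) (comul h) =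
             (counit h)%:A) ->
  g h * g' h = 1.
Proof.
move=> ch eh /(_ h); rewrite ch eh scale1r => <-.
rewrite tensor_lift_linearE // => [u c v w|u c v w].
  by rewrite linearP mulrDl -scalerAl.
by rewrite linearP mulrDr -scalerAr.
Qed.

(* Replacing y by y - (xy + yx) / (2x) makes x and y anticommute. *)
Lemma cleft_generators (A : bundle H C) (u : C) :
  2%:R * u = 1 -> cleft A ->
  exists (x x' y : A) (a a' b : C),
    [/\ x * x' = 1, x' * x = 1, coact x = x ⊗ swX & coact y = 1 ⊗ swY + y ⊗ swX]
    /\ [/\ x * x = base A a, a * a' = 1, y * y = base A b & y * x = - (x * y)].
Proof.
move=> uu [g [g' [gco gg' g'g]]].
have [c1 cM] := coact_monoid A; have cD := linD (coact_linear A).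
have gL : linear g by move=> c v w; rewrite linearP.
have idL : linear (id : H -> H) by [].
have gmD := tensor_mapD gL idL.
have xx' := conv_grouplike (@comul_swX k) (@H4_counitX k) gg'.
have x'x := conv_grouplike (@comul_swX k) (@H4_counitX k) g'g.
have ee' := conv_grouplike (@comul1 k) (@H4_counit1 k) gg'.
have e'e := conv_grouplike (@comul1 k) (@H4_counit1 k) g'g.
have eco : coact (g 1) = g 1 ⊗ 1 by rewrite gco comul1 tensor_mapE.
pose x := g swX; pose x' := g' swX; rewrite -/x -/x' in xx' x'x.
have xco : coact x = x ⊗ swX by rewrite gco comul_swX tensor_mapE.
have x'co : coact x' = x' ⊗ swX by apply: coact_inv xco; rewrite ?swXX.
have e'co : coact (g' 1) = g' 1 ⊗ 1 by apply: coact_inv eco; rewrite ?mulr1.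
(* The coaction of g Y is g 1 ⊗ Y + g Y ⊗ X; multiplying by the coinvariant inverse of g 1 turns the
   first term into 1 ⊗ Y. *)
pose y := g' 1 * g swY.
have yco : coact y = 1 ⊗ swY + y ⊗ swX.
  rewrite cM e'co gco comul_swY gmD !tensor_mapE // -/(tens1 _) mulrDr !tens1M.
  by rewrite e'e.
clearbody x x' y.
have [a xx] : exists c, base A c = x * x.
  by apply/base_coinv; rewrite cM xco -/(hatX x) hatXX.
have [a' xx'2] : exists c, base A c = x' * x'.
  by apply/base_coinv; rewrite cM x'co -/(hatX x') hatXX.
have [d dE] : exists c, base A c = x * y + y * x.
  apply/base_coinv; rewrite cD !cM xco yco -/(hatX x) -/(hatY y) hatXY hatYX.
  by rewrite tensorDl !addrA [LHS](ACl ((2*3)*(1*4))) /= subrr addr0.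
have aa' : a * a' = 1.
  apply: (base_inj (b := A)); rewrite rmorphM rmorph1 /= xx xx'2.
  by rewrite mulrA -[x * x * x']mulrA xx' mulr1.
(* As x^-1 = x / a, the subtracted term is d / (2x); it contributes 2 (d / 2a) x^2 = d to the
   anticommutator with x. Its coaction is itself ⊗ X, so z keeps the form of the coaction of y. *)
pose z := y - base A (u * a' * d) * x.
have zco : coact z = 1 ⊗ swY + z ⊗ swX.
  rewrite cD (morphDN cD) cM coact_base xco yco -/(tens1 _) tens1M.
  by rewrite -addrA -pureNl -tensorDl.
have zx : z * x = - (x * z).
  apply/eqP; rewrite -addr_eq0 /z mulrBl mulrBr addrACA.
  rewrite [y * x + _]addrC -dE mulrA -base_central -!mulrA -xx -opprD -!rmorphM.
  rewrite -mulr2n -!rmorphMn -rmorphB /=.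
  have -> : u * (a' * d) * a *+ 2 = (2%:R * u) * (a * a') * d by ring.
  by rewrite uu aa' !mul1r subrr rmorph0.
have [b zz] : exists c, base A c = z * z.
  by apply/base_coinv; rewrite cM zco -/(hatY z) hatYY.
by exists x, x', z, a, a', b.
Qed.
End Cleft.

Theorem theorem4p3 (k : fieldType) (C : comAlgType k)
    (two_inv : exists u : C, 2%:R * u = 1)
    (A : bundle (H4_hopf k) C) :
  cleft A -> homotopically_trivial A.
Proof.
have [u uu] := two_inv.
move=> /(cleft_generators uu) [x [x' [y [a [a' [b [gens rels]]]]]]].
have [[xx' x'x xco yco] [xx aa' yy yx]] := (gens, rels).
exists (quat_bundle (0 : C)); split; first exact: quat0_trivial.
(* A single homotopy suffices; it runs from the trivial bundle to A, hence the symmetry. *)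
apply/Relation_Operators.rst_sym/Relation_Operators.rst_step.
pose i : {lrmorphism C -> sqrt_ext a} := @sqrt_in k C a.
(* The path t b of parameters: 0 at t = 0 and b at t = 1. *)
pose b0 : polyAlg (sqrt_ext a) := 'X * (i b)%:P.
exists (sqrt_ext a), i, (quat_bundle b0); split.
- exact: sqrt_finite_etale aa' uu.
(* At t = 0 both push-forwards are [quat 0] over the extension. *)
- apply: comodAlg_iso_trans (pushforward_quat_bundle i 0).
  have -> : i 0 = @poly_ev k _ 0 b0.
    by rewrite rmorph0 /poly_ev hornerM hornerX mul0r.
  exact/comodAlg_iso_sym/pushforward_quat_bundle.
have ib : i b = @poly_ev k _ 1 b0.
  by rewrite /poly_ev hornerM hornerX hornerC mul1r.
have ss : sqrt_root a * sqrt_root a = i a by exact: sqrt_rootM.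
(* The root is a unit with inverse s / a. *)
have ss' : sqrt_root a * (i a' * sqrt_root a) = 1.
  by rewrite mulrCA ss -rmorphM mulrC aa' rmorph1.
apply: comodAlg_iso_trans (pushforward_quat xx' x'x xco yco xx yy yx ss' ss).
by rewrite ib; apply/comodAlg_iso_sym/pushforward_quat_bundle.
Qed.
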